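(* The Weil-Petersson curvature operator $\tilde Q$ on $T_H(1)$ is bounded. More precisely, for any $V\in\wedge^2TT_H(1)$ with $\|V\|_{eu}=1$, $$|\tilde Q(V,V)|\le 16\sqrt{\frac{3}{\pi}},$$ where $\|\cdot\|_{eu}$ is the norm of the inner product $\langle V_1\wedge V_2,V_3\wedge V_4\rangle_{eu}=\langle V_1,V_3\rangle\langle V_2,V_4\rangle-\langle V_1,V_4\rangle\langle V_2,V_3\rangle$.
   Context: Setting. $\mathbb D$ is the unit disk with hyperbolic metric $\rho(z)|dz|^2$, $\rho(z)=\frac{4}{(1-|z|^2)^2}$, area element $dA=\rho|dz|^2$ ($|dz|^2$ is Lebesgue measure), Laplacian $\Delta_\rho=\frac{4}{\rho}\partial_z\partial_{\bar z}$. $D=-2(\Delta_\rho-2)^{-1}$: for a bounded smooth $f$, $D(f)$ is the bounded smooth solution $u$ of $(\Delta_\rho-2)u=-2f$; it is given by a Green's function, $D(f)(z)=\int_{\mathbb D}G(z,w)f(w)\,dA(w)$, with $G>0$, $G(z,w)=G(w,z)$, $\int_{\mathbb D}G(z,w)\,dA(w)=1$. $H^{-1,1}(\mathbb D)$ is the complex Hilbert space of functions $\nu=\bar q/\rho$ with $q$ holomorphic on $\mathbb D$ and $\int_{\mathbb D}|q|^2\rho^{-1}|dz|^2<\infty$, with inner product $\langle\mu,\nu\rangle=\int_{\mathbb D}\mu\bar\nu\,dA$. It has the orthonormal basis $\mu_{n-1}(z)=\frac{(1-|z|^2)^2}{4}\sqrt{\frac{2n^3-2n}{\pi}}\,\bar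 z^{\,n-2}$, $n\ge2$. $T_H(1)$ is the universal Teichmüller space with the Takhtajan–Teo Hilbert manifold structure: a complex Hilbert manifold whose holomorphic tangent space at each point $P$ is identified with $H^{-1,1}(\mathbb D)$, the Weil-Petersson metric at $P$ being the inner product $\langle\mu,\nu\rangle=\int_{\mathbb D}\mu\bar\nu\,dA$ on $H^{-1,1}(\mathbb D)$. Near $P$ take holomorphic coordinates $t_i=x_i+\mathbf i y_i$ ($i\ge1$) with $\frac{\partial}{\partial t_i}|_P=\mu_i$; $\frac{\partial}{\partial x_i}=\frac{\partial}{\partial t_i}+\frac{\partial}{\partial\bar t_i}$, $\frac{\partial}{\partial y_i}=\mathbf i\big(\frac{\partial}{\partial t_i}-\frac{\partial}{\partial\bar t_i}\big)$. The real tangent space has orthonormal basis $\{\frac{\partial}{\partial x_i},\frac{\partial}{\partial y_i}\}_{i\ge1}$ at $P$. The curvature tensor $R$ of this Kähler metric, extended complex multilinearly, has the usual Riemannian symmetries (antisymmetric in the first two and in the last two arguments, symmetric under exchanging the two pairs), vanishes when its first two arguments (or its last two) are both of type $(1,0)$ or both of type $(0,1)$, and satisfies $R_{i\bar jk\bar\ell}=R(\frac{\partial}{\partial t_i},\frac{\partial}{\partial\bar t_j},\frac{\partial}{\partial t_k},\frac{\partial}{\partial\bar t_\ell})=\int_{\mathbb D}D(\mu_i\bar\mu_j)\mu_k\bar\mu_\ell\,dA+\int_{\mathbb D}D(\mu_i\bar\mu_\ell)\mu_k\bar\mu_j\,dA$. $\wedge^2TT_H(1)$ (at $P$) is the real Hilbert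 space spanned by $\frac{\partial}{\partial x_i}\wedge\frac{\partial}{\partial x_j}$, $\frac{\partial}{\partial x_i}\wedge\frac{\partial}{\partial y_j}$, $\frac{\partial}{\partial y_i}\wedge\frac{\partial}{\partial y_j}$ (closed span, square-summable coefficients) with the inner product $\langle\cdot,\cdot\rangle_{eu}$. The curvature operator $\tilde Q$ is the symmetric bilinear form with $\tilde Q(V_1\wedge V_2,V_3\wedge V_4)=R(V_1,V_2,V_3,V_4)$ for real tangent vectors, extended bilinearly (and to infinite sums as the limit over truncations $i,j\le N$, $N\to\infty$). *)

(* Defs.v *)
From HB Require Import structures.
From mathcomp Require Import all_boot all_order all_algebra.
From mathcomp Require Import all_classical all_reals all_analysis.
From mathcomp Require Import measurable_realfun.
From mathcomp Require Import complex.

Set Implicit Arguments.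
Unset Strict Implicit.
Unset Printing Implicit Defensive.

Import Order.TTheory GRing.Theory Num.Theory.
Import numFieldNormedType.Exports.

Local Open Scope classical_set_scope.
Local Open Scope ring_scope.
Local Open Scope complex_scope.

(* The plane is [R * R] when it carries a measure or a real differentiable
   structure, and [R[i]] when the complex structure is needed. *)

Definition toC (R : realType) (p : R * R) : R[i] := p.1 +i* p.2.

Definition disk (R : realType) : set (R * R) :=
  [set p | p.1 ^+ 2 + p.2 ^+ 2 < 1].

(** ** Hyperbolic metric and integration *)

Definition rho (R : realType) (p : R * R) : R :=
  4 / (1 - (p.1 ^+ 2 + p.2 ^+ 2)) ^+ 2.

(* [R * R] with the measurable structure on which the product measure is
   declared *)
Notation mplane R := (measurableTypeR R * measurableTypeR R)%type.

Definition plane_measure (R : realType) : set (mplane R) -> \bar R :=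
  (@lebesgue_measure R \x @lebesgue_measure R)%E.

Definition intdA (R : realType) (f : R * R -> R[i]) : R[i] :=
  (\int[@plane_measure R]_(p in @disk R) (complex.Re (f p) * rho p))
  +i* (\int[@plane_measure R]_(p in @disk R) (complex.Im (f p) * rho p)).

(** ** The operator [D = -2 (Delta_rho - 2)^-1] *)

Definition dx (R : realType) (g : R * R -> R) : R * R -> R :=
  fun p => 'D_((1, 0) : R * R) g p.
Definition dy (R : realType) (g : R * R -> R) : R * R -> R :=
  fun p => 'D_((0, 1) : R * R) g p.

(* C^oo: every iterated partial derivative is differentiable at every point of
   the disk; [b : bool] selects the direction of each differentiation. *)
Definition smoothR (R : realType) (g : R * R -> R) : Prop :=
  forall (s : seq bool) (p : R * R), @disk R p ->
    differentiable
      (foldr (fun b h => if b then dx h else dy h) g s : R * R -> R) p.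

Definition smooth (R : realType) (f : R * R -> R[i]) : Prop :=
  smoothR (fun p => complex.Re (f p)) /\ smoothR (fun p => complex.Im (f p)).

Definition bounded_on_disk (R : realType) (f : R * R -> R[i]) : Prop :=
  exists M : R, forall p, @disk R p -> `|f p| <= M%:C.

Definition dxC (R : realType) (f : R * R -> R[i]) : R * R -> R[i] :=
  fun p => dx (fun q => complex.Re (f q)) p +i* dx (fun q => complex.Im (f q)) p.
Definition dyC (R : realType) (f : R * R -> R[i]) : R * R -> R[i] :=
  fun p => dy (fun q => complex.Re (f q)) p +i* dy (fun q => complex.Im (f q)) p.

Definition dz (R : realType) (f : R * R -> R[i]) : R * R -> R[i] :=
  fun p => (dxC f p - (0 +i* 1) * dyC f p) / 2.
Definition dzbar (R : realType) (f : R * R -> R[i]) : R * R -> R[i] :=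
  fun p => (dxC f p + (0 +i* 1) * dyC f p) / 2.

Definition laplacian (R : realType) (f : R * R -> R[i]) : R * R -> R[i] :=
  fun p => (4 / rho p)%:C * dz (dzbar f) p.

Definition D_solution (R : realType) (f : R * R -> R[i])
    : set (R * R -> R[i]^o) :=
  [set u | [/\ bounded_on_disk u, smooth u &
     forall p, @disk R p -> laplacian u p - 2 * u p = - 2 * f p]].

(* Off the disk the value of [D f] is irrelevant. *)
Definition D (R : realType) (f : R * R -> R[i]) : R * R -> R[i] :=
  xget (cst 0) (D_solution f).

(* The last clause fixes which Green's function [G] is; values of [G] on the
   diagonal are immaterial. *)
Definition green_function (R : realType) (G : R * R -> R * R -> R) : Prop :=
  [/\ measurable_fun (@disk R `*` @disk R : set (mplane R * mplane R))
        (fun zw => G zw.1 zw.2),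
      forall z w, @disk R z -> @disk R w -> 0 < G z w,
      forall z w, @disk R z -> @disk R w -> G z w = G w z,
      forall z, @disk R z ->
        (\int[@plane_measure R]_(w in @disk R) (G z w * rho w)%:E = 1)%E &
      forall f : R * R -> R[i], bounded_on_disk f -> smooth f ->
        forall z, @disk R z -> D f z = intdA (fun w => (G z w)%:C * f w)].

(** ** The holomorphic tangent space and its complexification *)

Definition holomorphic_on_disk (R : realType) (q : R[i] -> R[i]) : Prop :=
  forall p, @disk R p -> derivable (q : R[i]^o -> R[i]^o) (toC p) 1.

(* Elements are extended by 0 off the disk, so that equality of functions on
   the plane is equality on the disk. *)
Definition H11 (R : realType) : set (R * R -> R[i]^o) :=
  [set nu | exists q : R[i] -> R[i],
     [/\ holomorphic_on_disk q,
         (\int[@plane_measure R]_(p in @disk R)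
            ((Normc.normc (q (toC p))) ^+ 2 / rho p)%:E < +oo)%E &
         nu = (fun p => if p \in @disk R then (q (toC p))^* / (rho p)%:C
                        else 0)]].

Definition inner11 (R : realType) (mu nu : R * R -> R[i]) : R[i] :=
  intdA (fun p => mu p * (nu p)^*).

(* [mu i] is defined for [1 <= i], with [n = i + 1] *)
Definition mu (R : realType) (i : nat) : R * R -> R[i]^o :=
  let n := i.+1 in
  fun p => if p \in @disk R then
      ((1 - (p.1 ^+ 2 + p.2 ^+ 2)) ^+ 2 / 4
       * Num.sqrt ((2 * n%:R ^+ 3 - 2 * n%:R) / pi))%:C
      * ((toC p)^*) ^+ (n - 2)
    else 0.

(* A complexified tangent vector is a pair [(X^{1,0}, X^{0,1})]; the (0,1) part
   is recorded as the pointwise conjugate of an element of [H11], so that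
   scalar multiplication is complex linear on both components. *)
Definition cvect (R : realType) : Type :=
  ((R * R -> R[i]^o) * (R * R -> R[i]^o))%type.

Definition tangent (R : realType) : set (cvect R) :=
  [set X | @H11 R X.1 /\ @H11 R (fun p => (X.2 p)^*)].

Definition type10 (R : realType) (X : cvect R) : Prop := X.2 = 0.
Definition type01 (R : realType) (X : cvect R) : Prop := X.1 = 0.

Definition vt (R : realType) (i : nat) : cvect R := (@mu R i, 0).
Definition vtbar (R : realType) (i : nat) : cvect R :=
  (0, fun p => (@mu R i p)^*).
Definition vx (R : realType) (i : nat) : cvect R := vt R i + vtbar R i.
Definition vy (R : realType) (i : nat) : cvect R :=
  (0 +i* 1 : R[i]) *: (vt R i - vtbar R i).

(* The Riemannian metric on real tangent vectors, which are the [X] whose (0,1)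
   part is the conjugate of the (1,0) part. *)
Definition metric (R : realType) (X Y : cvect R) : R :=
  complex.Re (inner11 X.1 Y.1).

(** ** Curvature tensor *)

(* The complex multilinear extension of the Weil-Petersson curvature tensor at
   a point of T_H(1), the holomorphic tangent space there being identified with
   [H11]. *)

Definition tensor4 (R : realType) : Type :=
  cvect R -> cvect R -> cvect R -> cvect R -> R[i]^o.

Definition lin_on_tangent (R : realType) (h : cvect R -> R[i]^o) : Prop :=
  forall (a : R[i]) X Y, @tangent R X -> @tangent R Y ->
    h (a *: X + Y) = a * h X + h Y.

Record wp_curvature_tensor (R : realType) (Rm : tensor4 R) : Prop := {
  wp_lin1 : forall Y Z W, tangent Y -> tangent Z -> tangent W ->
    lin_on_tangent (fun X => Rm X Y Z W);
  wp_lin2 : forall X Z W, tangent X -> tangent Z -> tangent W ->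
    lin_on_tangent (fun Y => Rm X Y Z W);
  wp_lin3 : forall X Y W, tangent X -> tangent Y -> tangent W ->
    lin_on_tangent (fun Z => Rm X Y Z W);
  wp_lin4 : forall X Y Z, tangent X -> tangent Y -> tangent Z ->
    lin_on_tangent (fun W => Rm X Y Z W);
  wp_anti12 : forall X Y Z W,
    tangent X -> tangent Y -> tangent Z -> tangent W ->
    Rm X Y Z W = - Rm Y X Z W;
  wp_anti34 : forall X Y Z W,
    tangent X -> tangent Y -> tangent Z -> tangent W ->
    Rm X Y Z W = - Rm X Y W Z;
  wp_pairs : forall X Y Z W,
    tangent X -> tangent Y -> tangent Z -> tangent W ->
    Rm X Y Z W = Rm Z W X Y;
  wp_type12 : forall X Y Z W,
    tangent X -> tangent Y -> tangent Z -> tangent W ->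
    (type10 X /\ type10 Y) \/ (type01 X /\ type01 Y) -> Rm X Y Z W = 0;
  wp_type34 : forall X Y Z W,
    tangent X -> tangent Y -> tangent Z -> tangent W ->
    (type10 Z /\ type10 W) \/ (type01 Z /\ type01 W) -> Rm X Y Z W = 0;
  wp_formula : forall i j k l : nat,
    (0 < i)%N -> (0 < j)%N -> (0 < k)%N -> (0 < l)%N ->
    Rm (vt R i) (vtbar R j) (vt R k) (vtbar R l) =
      intdA (fun p => D (fun w => @mu R i w * (@mu R j w)^*) p
                      * (@mu R k p * (@mu R l p)^*))
    + intdA (fun p => D (fun w => @mu R i w * (@mu R l w)^*) p
                      * (@mu R k p * (@mu R j p)^*))
}.

(** ** The second exterior power and the curvature operator *)

(* The bivector sum_{i<j} cxx i j x_i /\ x_j + sum_{i,j} cxy i j x_i /\ y_j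
   + sum_{i<j} cyy i j y_i /\ y_j, all indices being >= 1; the entries of the
   coefficient families outside these ranges are not used. *)
Record bivector (R : realType) : Type := Bivector {
  cxx : nat -> nat -> R;
  cxy : nat -> nat -> R;
  cyy : nat -> nat -> R
}.

Definition square_summable (R : realType) (V : bivector R) : Prop :=
  [/\ (\esum_(p in [set p : nat * nat | (0 < p.1 < p.2)%N])
         ((cxx V p.1 p.2) ^+ 2)%:E < +oo)%E,
      (\esum_(p in [set p : nat * nat | (0 < p.1)%N && (0 < p.2)%N])
         ((cxy V p.1 p.2) ^+ 2)%:E < +oo)%E &
      (\esum_(p in [set p : nat * nat | (0 < p.1 < p.2)%N])
         ((cyy V p.1 p.2) ^+ 2)%:E < +oo)%E].

(* [truncation V N] lists the terms [c * (X /\ Y)] of [V] with indices <= N,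
   as triples [(c, (X, Y))]. *)
Definition truncation (R : realType) (V : bivector R) (N : nat)
    : seq (R * (cvect R * cvect R)) :=
  let idx := [seq (i, j) | i <- iota 1 N, j <- iota 1 N] in
  let idx' := [seq p <- idx | p.1 < p.2]%N in
  [seq (cxx V p.1 p.2, (vx R p.1, vx R p.2)) | p <- idx']
  ++ [seq (cxy V p.1 p.2, (vx R p.1, vy R p.2)) | p <- idx]
  ++ [seq (cyy V p.1 p.2, (vy R p.1, vy R p.2)) | p <- idx'].

(* Bilinear extension of <V1 /\ V2, V3 /\ V4>_eu to finite sums. *)
Definition eu_trunc (R : realType) (V W : bivector R) (N : nat) : R :=
  \sum_(s <- truncation V N) \sum_(t <- truncation W N)
    s.1 * t.1 * (metric s.2.1 t.2.1 * metric s.2.2 t.2.2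
                 - metric s.2.1 t.2.2 * metric s.2.2 t.2.1).

Definition eu_inner (R : realType) (V W : bivector R) : R :=
  limn (eu_trunc V W).

Definition eu_norm (R : realType) (V : bivector R) : R :=
  Num.sqrt (eu_inner V V).

Definition Qtilde_trunc (R : realType) (Rm : tensor4 R) (V W : bivector R)
    (N : nat) : R[i]^o :=
  \sum_(s <- truncation V N) \sum_(t <- truncation W N)
    (s.1 * t.1)%:C * Rm s.2.1 s.2.2 t.2.1 t.2.2.

Definition Qtilde (R : realType) (Rm : tensor4 R) (V W : bivector R) : R[i]^o :=
  limn (Qtilde_trunc Rm V W).

(* [Qtilde] is a well defined bounded bilinear form *)
Definition bounded_curvature_operator (R : realType) (Rm : tensor4 R) : Prop :=
  (forall V W : bivector R, square_summable V -> square_summable W ->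
     cvgn (Qtilde_trunc Rm V W)) /\
  exists M : R, forall V W : bivector R,
    square_summable V -> square_summable W ->
    `|Qtilde Rm V W| <= (M * eu_norm V * eu_norm W)%:C.

(* Main.v *)
Require Import Defs.
From HB Require Import structures.
From mathcomp Require Import all_boot all_order all_algebra.
From mathcomp Require Import all_classical all_reals all_analysis.
From mathcomp Require Import measurable_realfun.
From mathcomp Require Import complex.
From mathcomp Require Import ring lra.

(** [Qtilde] is a limit of truncations, so the estimate has to be uniform in [N] and of product
    form: applied to tails of the coefficient families it makes the truncations Cauchy, and passed
    to the limit it gives the bound. Schur's test, on the other hand, wants a function of w plus a
    function of z. The product |F| |E| is therefore split by the arithmetic-geometric mean
    inequality with a free weight [s], and [s] is optimised only after integration. One dominating
    function serves both terms, because in F(w,w) E(z,z) and in F(w,z) E(z,w) the first argument of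
    F is w and that of E is z.

    Since the area stays a symbol, the [mu i] are only known to be orthogonal with squared norm
    area/pi. The estimate gains one such factor through h, while the product of the two Euclidean
    norms carries two, so the constant comes out as 6/area.

    [D] is only ever applied to products of a [mu i] and a conjugate [mu j]. On the disk these are
    polynomials, hence bounded and smooth, and the Green representation applies to them. *)

(* Since the curvature tensor vanishes on pairs of vectors of equal type,
   [Qtilde] only sees the (1,1) part [sum c_ij d/dt_i /\ d/dtbar_j] of a
   bivector, and [sum |c_ij|^2] is at most four times the sum of the squares of
   its real coefficients.  With
   [F(w,z) = sum c_ij mu_i(w) conj(mu_j(z))], and [E] built likewise from the
   second bivector, the two terms of the curvature formula become the integrals
   of [G(z,w) F(w,w) E(z,z)] and of [G(z,w) F(w,z) E(z,w)].  The kernel bound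
   [sum |mu_j|^2 <= 3/(4 pi)] gives [|F(w,z)|^2 <= 3/(4 pi) h(w)], where
   [h(w) = sum_j |sum_i c_ij mu_i(w)|^2] has integral [area/pi * sum |c_ij|^2];
   as [G] has total mass one in each variable, Schur's test bounds both terms.
   The Gram matrix of the [mu_i] comes from the divergence theorem on the disk
   (Fubini and the fundamental theorem of calculus on chords), which yields
   recurrences between the moments of [z^a zbar^b (1-|z|^2)^k].  Only
   [area >= 1] is used, and the resulting bound is [6 <= 16 sqrt(3/pi)]. *)

Import Order.TTheory GRing.Theory Num.Theory.
Import numFieldNormedType.Exports.
Local Open Scope classical_set_scope.
Local Open Scope ring_scope.
Local Open Scope complex_scope.

Set Implicit Arguments.
Unset Strict Implicit.
Unset Printing Implicit Defensive.

(** * Complex numbers and complex-valued integrals *)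

Local Notation Re := (@complex.Re _).
Local Notation Im := (@complex.Im _).
Local Notation normc := (@Normc.normc _).

Section complex_arith.
Context {R : realType}.
Implicit Types x y z : R[i].

Lemma ReD x y : Re (x + y) = Re x + Re y. Proof. by case: x y => [a b] []. Qed.
Lemma ImD x y : Im (x + y) = Im x + Im y. Proof. by case: x y => [a b] []. Qed.
Lemma ReM x y : Re (x * y) = Re x * Re y - Im x * Im y.
Proof. by case: x y => [a b] []. Qed.
Lemma ImM x y : Im (x * y) = Re x * Im y + Im x * Re y.
Proof. by case: x y => [a b] []. Qed.
Lemma ReMr x (a : R) : Re (x * a%:C) = Re x * a.
Proof. by rewrite ReM mulr0 subr0. Qed.
Lemma ImMr x (a : R) : Im (x * a%:C) = Im x * a.
Proof. by rewrite ImM mulr0 add0r. Qed.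

Lemma sqr_normcE x : normc x ^+ 2 = Re x ^+ 2 + Im x ^+ 2.
Proof. by case: x => a b /=; rewrite sqr_sqrtr // addr_ge0 ?sqr_ge0. Qed.

Lemma normcC x : x * conjc x = (normc x ^+ 2)%:C.
Proof.
rewrite sqr_normcE; case: x => a b; apply/eqP; rewrite eq_complex /=.
by apply/andP; split; apply/eqP; ring.
Qed.

Lemma normc_ge0 x : 0 <= normc x.
Proof. by case: x => a b; exact: sqrtr_ge0. Qed.

Lemma normc_conj x : normc (conjc x) = normc x.
Proof. by case: x => a b /=; rewrite sqrrN. Qed.

Lemma normc_real (a : R) : normc a%:C = `|a|.
Proof. by rewrite /= expr0n addr0 sqrtr_sqr. Qed.

Lemma normc_complexE x : `|x| = (normc x)%:C.
Proof. by case: x => a b; rewrite normc_def. Qed.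

Lemma normc_ge_Re x : `|Re x| <= normc x.
Proof.
rewrite -(ler_pXn2r (n := 2)) ?nnegrE ?normc_ge0 ?normr_ge0//.
by rewrite sqr_normcE real_normK ?num_real// lerDl sqr_ge0.
Qed.

Lemma normc_ge_Im x : `|Im x| <= normc x.
Proof.
rewrite -(ler_pXn2r (n := 2)) ?nnegrE ?normc_ge0 ?normr_ge0//.
by rewrite sqr_normcE real_normK ?num_real// lerDr sqr_ge0.
Qed.

Lemma normc_le_ReIm x : normc x <= `|Re x| + `|Im x|.
Proof.
rewrite -(ler_pXn2r (n := 2)) ?nnegrE ?normc_ge0 ?addr_ge0//.
rewrite sqr_normcE sqrrD !real_normK ?num_real// addrAC lerDl.
by rewrite mulrn_wge0// mulr_ge0.
Qed.

(* In ring expressions [x^*] parses as [Num.conj x], elsewhere as [conjc x]. *)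
Lemma conjE x : Num.conj x = conjc x. Proof. by []. Qed.

Lemma conjcM x y : conjc (x * y) = conjc x * conjc y.
Proof. exact: (rmorphM conjc). Qed.

Lemma conjcX x n : conjc (x ^+ n) = conjc x ^+ n.
Proof. exact: (rmorphXn conjc). Qed.

Lemma normcX x n : normc (x ^+ n) = normc x ^+ n.
Proof.
elim: n => [|n IH]; first by rewrite !expr0 Normc.normc1.
by rewrite !exprS Normc.normcM IH.
Qed.

Lemma conjc_sum (I : Type) (s : seq I) (P : pred I) (f : I -> R[i]) :
  conjc (\sum_(i <- s | P i) f i) = \sum_(i <- s | P i) conjc (f i).
Proof. exact: (rmorph_sum conjc). Qed.

Lemma normc_sum (I : Type) (s : seq I) (P : pred I) (f : I -> R[i]) :
  normc (\sum_(i <- s | P i) f i) <= \sum_(i <- s | P i) normc (f i).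
Proof.
elim/big_ind2: _ => [|x a y b xa yb|//]; first by rewrite Normc.normc0.
exact: (le_trans (le_normcD _ _) (lerD xa yb)).
Qed.

End complex_arith.

Section cintegral.
Context d (T : measurableType d) (R : realType).
Variables (m : {measure set T -> \bar R}) (D : set T) (mD : measurable D).
Implicit Types f g : T -> R[i].

Definition cintegral f : R[i] :=
  (\int[m]_(x in D) Re (f x)) +i* (\int[m]_(x in D) Im (f x)).

Definition cintegrable f : Prop :=
  m.-integrable D (EFin \o (Re \o f)) /\ m.-integrable D (EFin \o (Im \o f)).

Lemma eq_cintegral f g : {in D, f =1 g} -> cintegral f = cintegral g.
Proof.
by move=> fg; congr Complex; apply: eq_Rintegral => x xD; rewrite fg.
Qed.

Lemma eq_cintegrable f g : {in D, f =1 g} -> cintegrable f -> cintegrable g.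
Proof.
by move=> fg [fR fI]; split; [apply: eq_integrable fR|apply: eq_integrable fI];
  rewrite // => x xD /=; rewrite fg.
Qed.

Lemma cintegrable0 : cintegrable (fun=> 0).
Proof. by split; exact: integrable0. Qed.

Lemma cintegrableD f g : cintegrable f -> cintegrable g ->
  cintegrable (fun x => f x + g x).
Proof.
move=> [fR fI] [gR gI]; split.
- apply: eq_integrable (integrableD mD fR gR) => // x _ /=.
  by rewrite ReD EFinD.
- apply: eq_integrable (integrableD mD fI gI) => // x _ /=.
  by rewrite ImD EFinD.
Qed.

Lemma cintegralD f g : cintegrable f -> cintegrable g ->
  cintegral (fun x => f x + g x) = cintegral f + cintegral g.
Proof.
move=> [fR fI] [gR gI]; apply/eqP; rewrite eq_complex /cintegral /=.
under eq_Rintegral do rewrite ReD.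
under [X in _ && (X == _)]eq_Rintegral do rewrite ImD.
by rewrite !RintegralD// !eqxx.
Qed.

Lemma cintegrableZ c f : cintegrable f -> cintegrable (fun x => c * f x).
Proof.
move=> [fR fI]; split.
- apply: eq_integrable (integrableB mD
    (integrableZl mD (Re c) fR) (integrableZl mD (Im c) fI)) => // x _ /=.
  by rewrite ReM EFinB !EFinM.
- apply: eq_integrable (integrableD mD
    (integrableZl mD (Re c) fI) (integrableZl mD (Im c) fR)) => // x _ /=.
  by rewrite ImM EFinD !EFinM.
Qed.

Lemma integrableZE r (f : T -> R) : m.-integrable D (EFin \o f) ->
  m.-integrable D (EFin \o (fun x => r * f x)).
Proof.
by move=> /(integrableZl mD r); apply: eq_integrable.
Qed.

Lemma cintegralZ c f : cintegrable f ->
  cintegral (fun x => c * f x) = c * cintegral f.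
Proof.
move=> [fR fI]; apply/eqP; rewrite eq_complex /cintegral ReM ImM /=.
under eq_Rintegral do rewrite ReM.
under [X in _ && (X == _)]eq_Rintegral do rewrite ImM.
rewrite RintegralB ?RintegralD ?RintegralZl ?eqxx//; exact: integrableZE.
Qed.

Lemma cintegrable_sum (I : Type) (s : seq I) (f : I -> T -> R[i]) :
  (forall i, cintegrable (f i)) -> cintegrable (fun x => \sum_(i <- s) f i x).
Proof.
move=> fi; elim: s => [|i s IH].
  by apply: eq_cintegrable cintegrable0 => x _; rewrite big_nil.
by apply: eq_cintegrable (cintegrableD (fi i) IH) => x _; rewrite big_cons.
Qed.

Lemma cintegral_sum (I : Type) (s : seq I) (f : I -> T -> R[i]) :
  (forall i, cintegrable (f i)) ->
  cintegral (fun x => \sum_(i <- s) f i x) = \sum_(i <- s) cintegral (f i).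
Proof.
move=> fi; elim: s => [|i s IH].
  rewrite big_nil -[RHS](mul0r (cintegral (fun=> 0))) -cintegralZ; last first.
    exact: cintegrable0.
  by apply: eq_cintegral => x _; rewrite big_nil mul0r.
rewrite big_cons -IH -cintegralD//; last exact: cintegrable_sum.
by apply: eq_cintegral => x _; rewrite big_cons.
Qed.

(* Pairing with the conjugate of the integral turns the norm of the integral
   into the integral of a real part. *)
Lemma normc_cintegral_le f (h : T -> R) : cintegrable f ->
  m.-integrable D (EFin \o h) -> (forall x, D x -> normc (f x) <= h x) ->
  normc (cintegral f) <= \int[m]_(x in D) h x.
Proof.
move=> fi hi fh; set z := cintegral f.
have [->|z0] := eqVneq z 0.
  rewrite Normc.normc0; apply: Rintegral_ge0 => x Dx.
  exact: le_trans (normc_ge0 _) (fh x Dx).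
have nz0 : 0 < normc z.
  rewrite lt_neqAle normc_ge0 andbT eq_sym; apply/eqP => /Normc.eq0_normc.
  by apply/eqP.
rewrite -(ler_pM2l nz0) -RintegralZl//.
have -> : normc z * normc z = Re (cintegral (fun x => conjc z * f x)).
  by rewrite cintegralZ// [conjc _ * _]mulrC normcC expr2.
have [ciR _] := cintegrableZ (conjc z) fi.
apply: le_Rintegral => //; first exact: integrableZE.
move=> x Dx; apply: (le_trans (ler_norm _)); apply: (le_trans (normc_ge_Re _)).
by rewrite Normc.normcM normc_conj ler_wpM2l ?normc_ge0 ?fh.
Qed.

End cintegral.

(** * Polynomials in z and its conjugate *)

Section near_differentiable.
Context {R : numFieldType} {V W : normedModType R}.

(** The differential of [f] is selected by a choice operator, so one admissible candidate suffices.
    The differential of [g] is one, since the remainder depends only on the germ at [a]. *)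
Lemma near_eq_differentiable (f g : V -> W) (a : V) :
  (\near a, f a = g a) -> differentiable g a -> differentiable f a.
Proof.
move=> fg dg; apply/diffP => /=.
apply: (@getPex _ (fun (df : {linear V -> W}) => continuous df /\
  forall y, f y = f (lim (nbhs a)) + df (y - lim (nbhs a))
                  +o_(y \near a) (y - lim (nbhs a)))).
exists ('d g a); split; first exact: diff_continuous.
suff H : f = (fun y => f (lim (nbhs a)) + 'd g a (y - lim (nbhs a)))
    +o_a (center (lim (nbhs a))) by move=> y; rewrite {1}H.
have [[_ /eqaddoP dg']] := dg.
apply/eqaddoP => e e0; near=> y.
have -> : (f - (fun y => f (lim (nbhs a)) + 'd g a (y - lim (nbhs a)))) y =
    (g - (cst (g (lim (nbhs a))) + 'd g a \o center (lim (nbhs a)))) y.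
  rewrite !fctE /= lim_id// (nbhs_singleton fg) (_ : f y = g y)//.
  by near: y.
by near: y; exact: dg'.
Unshelve. all: by end_near. Qed.

End near_differentiable.

Section disk.
Context {R : realType}.

Lemma differentiable_fst (p : R * R) : differentiable (@fst R R) p.
Proof. by apply: linear_differentiable => x; exact: cvg_fst. Qed.

Lemma differentiable_snd (p : R * R) : differentiable (@snd R R) p.
Proof. by apply: linear_differentiable => x; exact: cvg_snd. Qed.

Lemma disk_open : open (@disk R).
Proof.
rewrite /disk.
have -> : [set p : R * R | p.1 ^+ 2 + p.2 ^+ 2 < 1] =
  (fun p : R * R => p.1 ^+ 2 + p.2 ^+ 2) @^-1` [set x | x < 1] by [].
apply: open_comp; last exact: open_lt.
move=> p _; apply: differentiable_continuous.
exact: (differentiableD (differentiableX 1 (differentiable_fst p))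
  (differentiableX 1 (differentiable_snd p))).
Qed.

Lemma near_disk (p : R * R) : disk p -> \near p, disk p.
Proof. by move=> Dp; exact: open_nbhs_nbhs (conj disk_open Dp). Qed.

End disk.

Section cexp.
Context {R : realType}.

(* Polynomials in [z] ([Zv]) and its conjugate ([Zb]). *)
Inductive cexp :=
| Cst of R[i] | Zv | Zb | Add of cexp & cexp | Mul of cexp & cexp.

Fixpoint eval (e : cexp) (p : R * R) : R[i] :=
  match e with
  | Cst c => c
  | Zv => toC p
  | Zb => (conjc (toC p))
  | Add a b => eval a p + eval b p
  | Mul a b => eval a p * eval b p
  end.

(* The derivation sending [z] to [u] and the conjugate of [z] to [v]: d/dx is
   [pd 1 1], d/dy is [pd 'i (- 'i)], and the Wirtinger derivatives are [pd 1 0]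
   and [pd 0 1]. *)
Fixpoint pd (u v : R[i]) (e : cexp) : cexp :=
  match e with
  | Cst _ => Cst 0
  | Zv => Cst u
  | Zb => Cst v
  | Add a b => Add (pd u v a) (pd u v b)
  | Mul a b => Add (Mul (pd u v a) b) (Mul a (pd u v b))
  end.

Local Notation ex := (pd 1 1).
Local Notation ey := (pd 'i (- 'i)).

Lemma eval_pd u v e p :
  eval (pd u v e) p = u * eval (pd 1 0 e) p + v * eval (pd 0 1 e) p.
Proof.
by elim: e => //= [c|||a -> b ->|a -> b ->]; ring.
Qed.

Lemma differentiable_eval e p :
  differentiable (Re \o eval e) p /\ differentiable (Im \o eval e) p.
Proof.
elim: e p => [c|||a IHa b IHb|a IHa b IHb] p /=.
- by split; exact: differentiable_cst.
- by split; [exact: differentiable_fst|exact: differentiable_snd].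
- split; first exact: differentiable_fst.
  exact: (differentiableN (differentiable_snd p)).
- have [aR aI] := IHa p; have [bR bI] := IHb p; split.
    rewrite (_ : _ \o _ = (Re \o eval a) + (Re \o eval b)); last first.
      by apply/funext => q /=; rewrite ReD.
    exact: differentiableD.
  rewrite (_ : _ \o _ = (Im \o eval a) + (Im \o eval b)); last first.
    by apply/funext => q /=; rewrite ImD.
  exact: differentiableD.
- have [aR aI] := IHa p; have [bR bI] := IHb p; split.
    rewrite (_ : _ \o _ = (Re \o eval a) * (Re \o eval b)
       - (Im \o eval a) * (Im \o eval b)); last first.
      by apply/funext => q /=; rewrite ReM.
    by apply: differentiableB; apply: differentiableM.
  rewrite (_ : _ \o _ = (Re \o eval a) * (Im \o eval b)
     + (Im \o eval a) * (Re \o eval b)); last first.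
    by apply/funext => q /=; rewrite ImM.
  by apply: differentiableD; apply: differentiableM.
Qed.

(** Chain rule along a curve with complex velocity [u]: the conjugate coordinate then moves with
    velocity [conjc u], which is why [v] is tied to [u]. *)
Lemma is_derive_eval (g : R -> R * R) (u v : R[i]) e (t : R) :
  is_derive t 1 (fst \o g) (Re u) -> is_derive t 1 (snd \o g) (Im u) ->
  v = conjc u ->
  is_derive t 1 (Re \o eval e \o g) (Re (eval (pd u v e) (g t))) /\
  is_derive t 1 (Im \o eval e \o g) (Im (eval (pd u v e) (g t))).
Proof.
move=> d1 d2 ->.
elim: e => [c|||a [aR aI] b [bR bI]|a [aR aI] b [bR bI]] /=.
- by split; exact: is_derive_cst.
- by [].
- case: u d1 d2 => u1 u2 /= d1 d2; split => //.
  exact: (@is_deriveN _ _ _ (snd \o g)).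
- rewrite ReD ImD; split.
    rewrite (_ : _ \o _ = (Re \o eval a \o g) + (Re \o eval b \o g)).
      exact: is_deriveD.
    by apply/funext => q /=; rewrite ReD.
  rewrite (_ : _ \o _ = (Im \o eval a \o g) + (Im \o eval b \o g)).
    exact: is_deriveD.
  by apply/funext => q /=; rewrite ImD.
- rewrite ReD ImD !ReM !ImM; split.
    rewrite (_ : _ \o _ = (Re \o eval a \o g) * (Re \o eval b \o g) -
      (Im \o eval a \o g) * (Im \o eval b \o g)).
      have h := is_deriveB (is_deriveM aR bR) (is_deriveM aI bI).
      by apply: is_derive_eq h _; rewrite /= /GRing.scale /=; ring.
    by apply/funext => q /=; rewrite ReM.
  rewrite (_ : _ \o _ = (Re \o eval a \o g) * (Im \o eval b \o g) +
      (Im \o eval a \o g) * (Re \o eval b \o g)).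
    have h := is_deriveD (is_deriveM aR bI) (is_deriveM aI bR).
    by apply: is_derive_eq h _; rewrite /= /GRing.scale /=; ring.
  by apply/funext => q /=; rewrite ImM.
Qed.

Lemma dx_eval e (p : R * R) :
  dx (Re \o eval e) p = Re (eval (ex e) p) /\
  dx (Im \o eval e) p = Im (eval (ex e) p).
Proof.
have H (f : R * R -> R) : dx f p = 'D_1 (f \o (fun t => (t, p.2))) p.1.
  rewrite /dx /derive; apply: (congr1 (fun k : R -> R => lim (k @ 0^'))).
  apply/funext => h /=; case: p => a b /=; congr (_ *: (f _ - _)).
  by congr (_, _); rewrite /= ?scaler0 ?add0r.
have d1 : is_derive p.1 1 (fst \o (fun t : R => (t, p.2))) (Re 1).
  exact: is_derive_id.
have d2 : is_derive p.1 1 (snd \o (fun t : R => (t, p.2))) (Im 1).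
  exact: is_derive_cst.
have [hR hI] := is_derive_eval e d1 d2 (esym (conjc1 _)).
rewrite !H; split.
- by rewrite (@derive_val _ _ _ _ _ _ _ hR); case: p {H d1 d2 hR hI}.
- by rewrite (@derive_val _ _ _ _ _ _ _ hI); case: p {H d1 d2 hR hI}.
Qed.

Lemma dy_eval e (p : R * R) :
  dy (Re \o eval e) p = Re (eval (ey e) p) /\
  dy (Im \o eval e) p = Im (eval (ey e) p).
Proof.
have H (f : R * R -> R) : dy f p = 'D_1 (f \o (fun t => (p.1, t))) p.2.
  rewrite /dy /derive; apply: (congr1 (fun k : R -> R => lim (k @ 0^'))).
  apply/funext => h /=; case: p => a b /=; congr (_ *: (f _ - _)).
  by congr (_, _); rewrite /= ?scaler0 ?add0r.
have d1 : is_derive p.2 1 (fst \o (fun t : R => (p.1, t))) (Re 'i).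
  exact: is_derive_cst.
have d2 : is_derive p.2 1 (snd \o (fun t : R => (p.1, t))) (Im 'i).
  exact: is_derive_id.
have vE : - 'i = conjc 'i :> R[i] by apply/eqP; rewrite eq_complex /= oppr0 !eqxx.
have [hR hI] := is_derive_eval e d1 d2 vE.
rewrite !H; split.
- by rewrite (@derive_val _ _ _ _ _ _ _ hR); case: p {H d1 d2 hR hI}.
- by rewrite (@derive_val _ _ _ _ _ _ _ hI); case: p {H d1 d2 hR hI}.
Qed.

(** Functions that agree on the disk with the real (or imaginary) part of a polynomial are stable
    under [dx] and [dy], because the disk is open. Agreement on the disk is all that can be asked:
    the [mu i] are cut to 0 outside it. *)
Lemma smooth_eval_on_disk e (f : R * R -> R[i]) :
  (forall p, disk p -> f p = eval e p) -> smooth f.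
Proof.
move=> fe.
pose P (h : R * R -> R) (k : R[i] -> R) :=
  exists e', forall p, disk p -> h p = k (eval e' p).
have step (k : R[i] -> R) (h : R * R -> R) s : P h k ->
    (forall e p, dx (k \o eval e) p = k (eval (ex e) p)) ->
    (forall e p, dy (k \o eval e) p = k (eval (ey e) p)) ->
    P (foldr (fun b h => if b then dx h else dy h) h s) k.
  move=> Ph kx ky; elim: s => [//|b s [e' he']] /=.
  exists ((if b then ex else ey) e') => p Dp.
  by case: b; rewrite -?kx -?ky; apply: near_eq_derive;
    move: (near_disk Dp); apply: filterS => q Dq; rewrite he'.
split=> s p Dp.
- have [e' he'] : P (foldr (fun b h => if b then dx h else dy h)
      (fun p => Re (f p)) s) Re.
    apply: step => [|e1 q|e1 q]; first by exists e => q /fe ->.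
      exact: (dx_eval e1 q).1.
    exact: (dy_eval e1 q).1.
  apply: (@near_eq_differentiable _ _ _ _ (Re \o eval e')).
    by move: (near_disk Dp); apply: filterS => q Dq; rewrite he'.
  exact: (differentiable_eval e' p).1.
- have [e' he'] : P (foldr (fun b h => if b then dx h else dy h)
      (fun p => Im (f p)) s) Im.
    apply: step => [|e1 q|e1 q]; first by exists e => q /fe ->.
      exact: (dx_eval e1 q).2.
    exact: (dy_eval e1 q).2.
  apply: (@near_eq_differentiable _ _ _ _ (Im \o eval e')).
    by move: (near_disk Dp); apply: filterS => q Dq; rewrite he'.
  exact: (differentiable_eval e' p).2.
Qed.

End cexp.

(** * The divergence theorem on the disk *)

Section plane_measure_instances.
Context {R : realType}.

Let l2 : {measure set (mplane R) -> \bar R} :=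
  (@lebesgue_measure R \x @lebesgue_measure R)%E.

HB.instance Definition _ := isMeasure.Build _ _ _ (@plane_measure R)
  (measure0 l2) (measure_ge0 l2) (@measure_semi_sigma_additive _ _ _ l2).

Lemma plane_measure_square (a b : R) : a <= b ->
  plane_measure (`[a, b]%classic `*` `[a, b]%classic) = ((b - a) ^+ 2)%:E.
Proof.
move=> ab; rewrite /plane_measure product_measure1E//= lebesgue_measure_itv/=.
by case: ltP => [_|ba]; rewrite ?expr2 // (le_anti (introT andP (conj ab ba)))
  subrr mulr0 mule0.
Qed.

Let plane_measure_sigma_finite : sigma_finite setT (@plane_measure R).
Proof.
exists (fun n : nat => `[- n%:R, n%:R]%classic `*` `[- n%:R, n%:R]%classic).
  apply/esym; rewrite -subTset => -[x y] _.
  pose n := Num.truncn (`|x| + `|y|); exists n.+1 => //=.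
  have : `|x| + `|y| < n.+1%:R by exact: truncnS_gt.
  by rewrite !in_itv/= -!ler_norml => h; split; apply: ltW (le_lt_trans _ h);
    rewrite ?lerDl ?lerDr.
move=> n; split; first exact: measurableX.
by rewrite plane_measure_square ?ltry// ge0_cp.
Qed.

HB.instance Definition _ := Measure_isSigmaFinite.Build _ _ _
  (@plane_measure R) plane_measure_sigma_finite.

End plane_measure_instances.

Section disk_integrals.
Context {R : realType}.
Local Notation pm := (@plane_measure R).
Local Notation D := (@disk R : set (mplane R)).

Lemma measurable_eval e :
  measurable_fun [set: mplane R] (Re \o eval e) /\
  measurable_fun [set: mplane R] (Im \o eval e).
Proof.
elim: e => [c|||a [aR aI] b [bR bI]|a [aR aI] b [bR bI]] /=.
- by split; exact: measurable_cst.
- by split; [exact: measurable_fst|exact: measurable_snd].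
- split; first exact: measurable_fst.
  exact: (measurableT_comp (@oppr_measurable _ _) measurable_snd).
- split.
    rewrite (_ : _ \o _ = (Re \o eval a) \+ (Re \o eval b)).
      exact: measurable_funD.
    by apply/funext => q /=; rewrite ReD.
  rewrite (_ : _ \o _ = (Im \o eval a) \+ (Im \o eval b)).
    exact: measurable_funD.
  by apply/funext => q /=; rewrite ImD.
- split.
    rewrite (_ : _ \o _ = ((Re \o eval a) \* (Re \o eval b)) \-
      ((Im \o eval a) \* (Im \o eval b))).
      by apply: measurable_funB; exact: measurable_funM.
    by apply/funext => q /=; rewrite ReM.
  rewrite (_ : _ \o _ = ((Re \o eval a) \* (Im \o eval b)) \+
      ((Im \o eval a) \* (Re \o eval b))).
    by apply: measurable_funD; exact: measurable_funM.
  by apply/funext => q /=; rewrite ImM.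
Qed.

Lemma measurable_disk : measurable D.
Proof.
have mf : measurable_fun [set: mplane R] (fun p => p.1 ^+ 2 + p.2 ^+ 2).
  apply: measurable_funD; apply: measurable_funX.
    exact: measurable_fst.
  exact: measurable_snd.
rewrite (_ : D = (fun p => p.1 ^+ 2 + p.2 ^+ 2) @^-1` `]-oo, 1[%classic).
  by rewrite -[X in measurable X]setTI; exact: mf.
by apply/seteqP; split=> p /=; rewrite in_itv.
Qed.

Lemma in_disk (p : R * R) : (p \in @disk R) = (p.1 ^+ 2 + p.2 ^+ 2 < 1).
Proof. by apply/idP/idP; rewrite inE. Qed.

Lemma disk_coord (p : R * R) : disk p -> `|p.1| <= 1 /\ `|p.2| <= 1.
Proof.
rewrite /disk/= -[_.1 ^+ 2]real_normK ?num_real// -[_.2 ^+ 2]real_normK ?num_real//.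
move=> h; have := sqr_ge0 `|p.1|; have := sqr_ge0 `|p.2|.
have := normr_ge0 p.1; have := normr_ge0 p.2.
by split; rewrite leNgt; apply/negP => ?; nra.
Qed.

Lemma plane_measure_disk_fin : (pm D < +oo)%E.
Proof.
apply: (@le_lt_trans _ _ (pm (`[-1, 1]%classic `*` `[-1, 1]%classic))).
  apply: le_measure; rewrite ?inE; [exact: measurable_disk|exact: measurableX|].
  by move=> p /disk_coord[]; rewrite !ler_norml/= !in_itv.
by rewrite plane_measure_square ?ltry// ge0_cp.
Qed.

Lemma eval_bounded e : exists M : R,
  forall p : R * R, disk p -> normc (eval e p) <= M.
Proof.
have tz (p : R * R) : disk p -> normc (toC p) <= 2.
  move=> /disk_coord[p1 p2]; apply: le_trans (normc_le_ReIm _) _ => /=; lra.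
elim: e => [c|||a [A hA] b [B hB]|a [A hA] b [B hB]] /=.
- by exists (normc c).
- by exists 2.
- by exists 2 => p Dp; have := tz p Dp; rewrite -normc_conj.
- exists (A + B) => p Dp; apply: le_trans (le_normcD _ _) _.
  by rewrite lerD ?hA ?hB.
- by exists (A * B) => p Dp; rewrite Normc.normcM ler_pM ?normc_ge0 ?hA ?hB.
Qed.

Lemma disk_integrable_bounded (f : mplane R -> R) (M : R) :
  measurable_fun setT f -> (forall p, disk p -> `|f p| <= M) ->
  pm.-integrable D (EFin \o f).
Proof.
move=> mf fM; apply: measurable_bounded_integrable.
- exact: measurable_disk.
- exact: plane_measure_disk_fin.
- exact: measurable_funS mf.
- exists M; split; first exact: num_real.
  by move=> x Mx p Dp; exact: le_trans (fM p Dp) (ltW Mx).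
Qed.

Lemma cintegrable_eval e : cintegrable pm D (eval e).
Proof.
have [M hM] := eval_bounded e; have [mR mI] := measurable_eval e.
split; apply: (@disk_integrable_bounded _ M) => // p Dp.
- exact: le_trans (normc_ge_Re _) (hM p Dp).
- exact: le_trans (normc_ge_Im _) (hM p Dp).
Qed.

(** Fundamental theorem of calculus on the chord at height [c], whose ends are plus or minus
    [Num.sqrt (1 - c ^+ 2)]; for [1 <= c ^+ 2] the chord is empty. The integrand is extended by 0 to
    the whole line, the form in which Fubini delivers it. *)
Lemma chord_integral0 (G g : R -> R) (c : R) :
  (forall t : R, is_derive t 1 G (g t)) -> continuous g ->
  (forall t, t ^+ 2 + c ^+ 2 = 1 -> G t = 0) ->
  (\int[lebesgue_measure]_t
    (if t ^+ 2 + c ^+ 2 < 1 then g t else 0)%:E = 0)%E.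
Proof.
move=> dG cg G0; have [c1|c1] := ltP (c ^+ 2) 1; last first.
  apply: integral0_eq => t _; case: ifPn => // h.
  by exfalso; move: h; have := sqr_ge0 (t : R); lra.
pose s : R := Num.sqrt (1 - c ^+ 2).
have s2 : s ^+ 2 = 1 - c ^+ 2 by rewrite sqr_sqrtr// subr_ge0 ltW.
have s0 : 0 < s by rewrite sqrtr_gt0 subr_gt0.
transitivity (\int[lebesgue_measure]_(t in `](- s)%R, s[) (g t)%:E)%E.
  rewrite [RHS]integral_mkcond; apply: eq_integral => t _.
  rewrite patchE mem_setE in_itv/=.
  have -> : (t ^+ 2 + c ^+ 2 < 1) = (- s < t < s).
    rewrite -ltr_norml -[RHS](@ltr_pXn2r _ 2) ?nnegrE ?normr_ge0 ?(ltW s0)//.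
    rewrite real_normK ?num_real// s2; apply/idP/idP => ?; lra.
  by case: ifP.
have mg : measurable_fun setT g by exact: continuous_measurable_fun.
rewrite -(@integral_itv_bndoo _ _ _ _ true false); last first.
  by apply/measurable_EFinP; exact: measurable_funS mg.
have ss : - s < s by lra.
have contG t : {for t, continuous G}.
  apply: differentiable_continuous; apply/derivable1_diffP.
  exact: (@ex_derive _ _ _ _ _ _ _ (dG t)).
rewrite (continuous_FTC2 (F := G) ss).
- have Gs : G s = 0 by apply: G0; rewrite s2 subrK.
  have GNs : G (- s) = 0 by apply: G0; rewrite sqrrN s2 subrK.
  by rewrite Gs GNs sube0.
- exact: continuous_subspaceT.
- split.
  + by move=> t _; exact: (@ex_derive _ _ _ _ _ _ _ (dG t)).
  + exact: cvg_at_right_filter (contG _).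
  + exact: cvg_at_left_filter (contG _).
- by move=> t _; rewrite derive1E (@derive_val _ _ _ _ _ _ _ (dG t)).
Qed.

Lemma disk_integral_dx (F f : R * R -> R) :
  (forall y t : R, is_derive t 1 (fun t => F (t, y)) (f (t, y))) ->
  (forall y, continuous (fun t => f (t, y))) ->
  pm.-integrable D (EFin \o f) ->
  (forall p, p.1 ^+ 2 + p.2 ^+ 2 = 1 -> F p = 0) ->
  \int[pm]_(p in D) f p = 0.
Proof.
move=> dF cf intf F0; rewrite /Rintegral integral_mkcond.
have intfD := proj1 (integrable_mkcond (mu := pm) (EFin \o f) measurable_disk) intf.
rewrite -(integral21_prod_meas1 (m1 := lebesgue_measure)
  (m2 := lebesgue_measure)); last first.
  exact: intfD.
rewrite (_ : integral _ _ _ = 0%E)//; apply: integral0_eq => y _.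
rewrite -[RHS](@chord_integral0 (fun t => F (t, y)) (fun t => f (t, y)) y)//.
  by apply: eq_integral => t _; rewrite patchE in_disk; case: ifP.
by move=> t ty; exact: F0.
Qed.

Lemma disk_integral_dy (F f : R * R -> R) :
  (forall x t : R, is_derive t 1 (fun t => F (x, t)) (f (x, t))) ->
  (forall x, continuous (fun t => f (x, t))) ->
  pm.-integrable D (EFin \o f) ->
  (forall p, p.1 ^+ 2 + p.2 ^+ 2 = 1 -> F p = 0) ->
  \int[pm]_(p in D) f p = 0.
Proof.
move=> dF cf intf F0; rewrite /Rintegral integral_mkcond.
have intfD := proj1 (integrable_mkcond (mu := pm) (EFin \o f) measurable_disk) intf.
rewrite -(integral12_prod_meas1 (m1 := lebesgue_measure)
  (m2 := lebesgue_measure)); last first.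
  exact: intfD.
rewrite (_ : integral _ _ _ = 0%E)//; apply: integral0_eq => x _.
rewrite -[RHS](@chord_integral0 (fun t => F (x, t)) (fun t => f (x, t)) x)//.
  by apply: eq_integral => t _; rewrite patchE in_disk addrC; case: ifP.
by move=> t ty; apply: F0; rewrite addrC.
Qed.

Lemma is_derive_eval_x e (y t : R) :
  is_derive t 1 (fun t => Re (eval e (t, y))) (Re (eval (pd 1 1 e) (t, y))) /\
  is_derive t 1 (fun t => Im (eval e (t, y))) (Im (eval (pd 1 1 e) (t, y))).
Proof.
apply: (@is_derive_eval R (fun t => (t, y)) 1 1 e t); last by rewrite conjc1.
by rewrite (_ : snd \o _ = cst y)//; exact: is_derive_cst.
Qed.

Lemma is_derive_eval_y e (x t : R) :
  is_derive t 1 (fun t => Re (eval e (x, t)))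
    (Re (eval (pd 'i (- 'i) e) (x, t))) /\
  is_derive t 1 (fun t => Im (eval e (x, t)))
    (Im (eval (pd 'i (- 'i) e) (x, t))).
Proof.
apply: (@is_derive_eval R (fun t => (x, t)) 'i (- 'i) e t).
- by rewrite (_ : fst \o _ = cst x)//; exact: is_derive_cst.
- by apply/eqP; rewrite eq_complex /= oppr0 !eqxx.
Qed.

Lemma is_derive1_continuous (f df : R -> R) :
  (forall t : R, is_derive t 1 f (df t)) -> continuous f.
Proof.
move=> d t; apply: differentiable_continuous; apply/derivable1_diffP.
exact: (@ex_derive _ _ _ _ _ _ _ (d t)).
Qed.

(* The divergence theorem for constant vector fields times [e]. *)
Lemma cintegral_pd u v e :
  (forall p : R * R, p.1 ^+ 2 + p.2 ^+ 2 = 1 -> eval e p = 0) ->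
  cintegral pm D (eval (pd u v e)) = 0.
Proof.
move=> e0.
have cx : cintegral pm D (eval (pd 1 1 e)) = 0.
  have [iR iI] := cintegrable_eval (pd 1 1 e); apply/eqP.
  rewrite eq_complex /=; apply/andP; split; apply/eqP.
    apply: (@disk_integral_dx (Re \o eval e)) => // [y t|y|p /e0 /= ->//].
      exact: (is_derive_eval_x e y t).1.
    exact: is_derive1_continuous (fun t => (is_derive_eval_x _ y t).1).
  apply: (@disk_integral_dx (Im \o eval e)) => // [y t|y|p /e0 /= ->//].
    exact: (is_derive_eval_x e y t).2.
  exact: is_derive1_continuous (fun t => (is_derive_eval_x _ y t).2).
have cy : cintegral pm D (eval (pd 'i (- 'i) e)) = 0.
  have [iR iI] := cintegrable_eval (pd 'i (- 'i) e); apply/eqP.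
  rewrite eq_complex /=; apply/andP; split; apply/eqP.
    apply: (@disk_integral_dy (Re \o eval e)) => // [y t|y|p /e0 /= ->//].
      exact: (is_derive_eval_y e y t).1.
    exact: is_derive1_continuous (fun t => (is_derive_eval_y _ y t).1).
  apply: (@disk_integral_dy (Im \o eval e)) => // [y t|y|p /e0 /= ->//].
    exact: (is_derive_eval_y e y t).2.
  exact: is_derive1_continuous (fun t => (is_derive_eval_y _ y t).2).
have i2 : 'i * 'i = -1 :> R[i] by rewrite -expr2 sqr_i.
have twoC : (2 : R[i]) != 0 by rewrite pnatr_eq0.
(* These solve a + b i = u and a - b i = v, which writes the derivation as a combination of d/dx and
   d/dy. *)
pose a : R[i] := (u + v) / 2; pose b : R[i] := (u - v) / 2 * - 'i.
have -> : cintegral pm D (eval (pd u v e)) = cintegral pm D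
    (fun p => a * eval (pd 1 1 e) p + b * eval (pd 'i (- 'i) e) p).
  apply: eq_cintegral => p _; rewrite eval_pd (eval_pd 1 1) (eval_pd 'i).
  have h (I P Q : R[i]) : I * I = -1 -> u * P + v * Q = (u + v) / 2 *
      (1 * P + 1 * Q) + (u - v) / 2 * - I * (I * P + - I * Q).
    move=> I2; transitivity
      ((u + v) / 2 * (P + Q) + (u - v) / 2 * (- (I * I)) * (P - Q)).
      by rewrite I2; field.
    by ring.
  exact: h.
have ax := cintegrableZ measurable_disk a (cintegrable_eval (pd 1 1 e)).
have ay := cintegrableZ measurable_disk b (cintegrable_eval (pd 'i (- 'i) e)).
rewrite (cintegralD measurable_disk ax ay).
rewrite !(cintegralZ measurable_disk) ?cx ?cy ?mulr0 ?addr0//;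
  exact: cintegrable_eval.
Qed.

End disk_integrals.

(** * Moments of the disk *)

Section moments.
Context {R : realType}.
Local Notation pm := (@plane_measure R).
Local Notation D := (@disk R : set (mplane R)).

Fixpoint Pow (e : @cexp R) n := if n is n.+1 then Mul e (Pow e n) else Cst 1.

Lemma eval_Pow e n p : eval (Pow e n) p = eval e p ^+ n.
Proof. by elim: n => [|n IH] /=; rewrite ?expr0// IH exprS. Qed.

Lemma eval_pd_Pow u v e n p :
  eval (pd u v (Pow e n.+1)) p = n.+1%:R * eval e p ^+ n * eval (pd u v e) p.
Proof.
elim: n => [|n IH]; first by rewrite /=; ring.
move: IH => /=; rewrite eval_Pow => ->.
by rewrite exprS -[n.+2]addn1 natrD; ring.
Qed.

Definition W : @cexp R := Add (Cst 1) (Mul (Cst (- 1)) (Mul Zv Zb)).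

Lemma eval_W (p : R * R) :
  eval W p = (1 - (p.1 ^+ 2 + p.2 ^+ 2))%:C.
Proof.
by rewrite /= normcC sqr_normcE /= mulN1r -rmorphN -rmorphD.
Qed.

Definition mono a b k : @cexp R := Mul (Pow Zv a) (Mul (Pow Zb b) (Pow W k)).

Lemma eval_mono a b k (p : R * R) : eval (mono a b k) p =
  toC p ^+ a * ((conjc (toC p)) ^+ b * eval W p ^+ k).
Proof. by rewrite [LHS]/= !eval_Pow. Qed.

Definition moment a b k : R[i] := cintegral pm D (eval (mono a b k)).

Lemma mono_circle a b k (p : R * R) : p.1 ^+ 2 + p.2 ^+ 2 = 1 ->
  eval (mono a b k.+1) p = 0.
Proof. by move=> p1; rewrite eval_mono eval_W p1 subrr exprS mul0r !mulr0. Qed.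

Lemma cintegral_lin2 (x y : R[i]) (e1 e2 : @cexp R) :
  cintegral pm D (fun p => x * eval e1 p + y * eval e2 p) =
  x * cintegral pm D (eval e1) + y * cintegral pm D (eval e2).
Proof.
have ax := cintegrableZ measurable_disk x (cintegrable_eval e1).
have ay := cintegrableZ measurable_disk y (cintegrable_eval e2).
by rewrite (cintegralD measurable_disk ax ay) !(cintegralZ measurable_disk)//;
  exact: cintegrable_eval.
Qed.

(** With W = 1 - |z|^2, differentiating z^(a+1) zbar^b W^(k+1) in z yields (a+1) z^a zbar^b W^(k+1)
    - (k+1) z^(a+1) zbar^(b+1) W^k. The integral of this vanishes, because W is zero on the
    circle. *)
Lemma moment_z a b k :
  a.+1%:R * moment a b k.+1 = k.+1%:R * moment a.+1 b.+1 k.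
Proof.
apply/eqP; rewrite -subr_eq0 -mulNr -cintegral_lin2; apply/eqP.
rewrite -[RHS](@cintegral_pd R 1 0 (mono a.+1 b k.+1)); last first.
  exact: mono_circle.
apply: eq_cintegral => p _; rewrite !eval_mono.
have -> : eval (pd 1 0 (mono a.+1 b k.+1)) p =
    eval (pd 1 0 (Pow Zv a.+1)) p * ((conjc (toC p)) ^+ b * eval W p ^+ k.+1) +
    toC p ^+ a.+1 * (eval (pd 1 0 (Pow Zb b)) p * eval W p ^+ k.+1 +
      (conjc (toC p)) ^+ b * eval (pd 1 0 (Pow W k.+1)) p).
  by rewrite /mono; cbn [pd eval]; rewrite !eval_Pow.
have -> : eval (pd 1 0 (Pow Zb b)) p = 0.
  by case: b => [//|b]; rewrite eval_pd_Pow /= mulr0.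
rewrite !eval_pd_Pow (_ : eval (pd 1 0 Zv) p = 1)//.
rewrite (_ : eval (pd 1 0 W) p = 0 + (0 * (toC p * (conjc (toC p))) +
  - 1 * (1 * (conjc (toC p)) + toC p * 0)))//.
by rewrite [(conjc (toC p)) ^+ b.+1]exprS (_ : eval Zv p = toC p)//; ring.
Qed.

Lemma moment_zb a b k :
  b.+1%:R * moment a b k.+1 = k.+1%:R * moment a.+1 b.+1 k.
Proof.
apply/eqP; rewrite -subr_eq0 -mulNr -cintegral_lin2; apply/eqP.
rewrite -[RHS](@cintegral_pd R 0 1 (mono a b.+1 k.+1)); last first.
  exact: mono_circle.
apply: eq_cintegral => p _; rewrite !eval_mono.
have -> : eval (pd 0 1 (mono a b.+1 k.+1)) p =
    eval (pd 0 1 (Pow Zv a)) p * ((conjc (toC p)) ^+ b.+1 * eval W p ^+ k.+1) +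
    toC p ^+ a * (eval (pd 0 1 (Pow Zb b.+1)) p * eval W p ^+ k.+1 +
      (conjc (toC p)) ^+ b.+1 * eval (pd 0 1 (Pow W k.+1)) p).
  by rewrite /mono; cbn [pd eval]; rewrite !eval_Pow.
have -> : eval (pd 0 1 (Pow Zv a)) p = 0.
  by case: a => [//|a]; rewrite eval_pd_Pow /= mulr0.
rewrite !eval_pd_Pow (_ : eval (pd 0 1 Zb) p = 1)//.
rewrite (_ : eval (pd 0 1 W) p = 0 + (0 * (toC p * (conjc (toC p))) +
  - 1 * (0 * (conjc (toC p)) + toC p * 1)))//.
by rewrite [toC p ^+ a.+1]exprS (_ : eval Zb p = (conjc (toC p)))//; ring.
Qed.

(** The recurrences in z and in zbar have the same right-hand side, so (a - b) kills the moment.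
    This takes the place of integrating over the angle in polar coordinates. *)
Lemma moment_off a b k : a != b -> moment a b k.+1 = 0.
Proof.
move=> ab; apply/eqP; have /eqP := etrans (moment_z a b k) (esym (moment_zb a b k)).
by rewrite -subr_eq0 -mulrBl mulf_eq0 subr_eq0 eqr_nat eqSS (negPf ab).
Qed.

Lemma moment_W a b k : moment a b k.+1 = moment a b k - moment a.+1 b.+1 k.
Proof.
rewrite -[X in X - _]mul1r -mulN1r -cintegral_lin2.
apply: eq_cintegral => p _; rewrite !eval_mono !exprS.
have -> : eval W p = 1 - toC p * (conjc (toC p)) by rewrite /= mulN1r.
by ring.
Qed.

(** Eliminating [moment n n 1] between [moment_z] and [moment_W] gives (n+2) M_(n+1) = (n+1) M_n for
    M_n = [moment n n 0]. *)
Lemma moment_diag0 n : n.+1%:R * moment n n 0 = moment 0 0 0.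
Proof.
elim: n => [|n IH]; first by rewrite mul1r.
rewrite -IH; have h1 := moment_z n n 0; have h2 := moment_W n n 0.
rewrite mul1r in h1; rewrite -{}h1 in h2 *.
transitivity (n.+1%:R * (moment n n 1 + n.+1%:R * moment n n 1)).
  by rewrite -[n.+2]addn1 natrD; ring.
by rewrite {1}h2 subrK.
Qed.

(** A Beta integral: [moment_z] is used twice to trade the two powers of W for powers of |z|^2. The
    product of three consecutive integers is the one in [mu_coef2]. *)
Lemma moment_diag2 m :
  (m.+1 * m.+2 * m.+3)%:R * moment m m 2 = 2 * moment 0 0 0.
Proof.
rewrite -(moment_diag0 m.+2) !natrM.
have h1 := moment_z m m 1; have := moment_z m.+1 m.+1 0; rewrite mul1r => h2.
rewrite -h2.
transitivity (m.+2%:R * m.+3%:R * (m.+1%:R * moment m m 2)); first by ring.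
by rewrite h1; ring.
Qed.

Definition area : R := fine (pm D).

Lemma moment000 : moment 0 0 0 = area%:C.
Proof.
rewrite /moment -[RHS](_ : cintegral pm D (fun=> 1) = _).
  by apply: eq_cintegral => p _; rewrite eval_mono !mulr1.
apply/eqP; rewrite eq_complex /=; apply/andP; split; apply/eqP.
  by rewrite Rintegral_cst ?mul1r//; exact: measurable_disk.
by rewrite Rintegral_cst ?mul0r//; exact: measurable_disk.
Qed.

(* The square of side 1 centred at 0 lies in the disk; the exact area is not
   needed. *)
Lemma area_ge1 : 1 <= area.
Proof.
rewrite -lee_fin fineK; last first.
  by rewrite ge0_fin_numE//; exact: plane_measure_disk_fin.
have <- : pm (`[- 2^-1, 2^-1]%classic `*` `[- 2^-1, 2^-1]%classic) = 1%E.
  by rewrite plane_measure_square; [congr EFin; field|lra].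
apply: le_measure; rewrite ?inE; [exact: measurableX|exact: measurable_disk|].
move=> [x y]; rewrite /disk/= !in_itv/= => -[/andP[x1 x2] /andP[y1 y2]].
by nra.
Qed.

End moments.

(** * The basis of the holomorphic tangent space *)

Section negative_binomial.
Context {R : realFieldType}.

(** Pascal's rule: multiplying by 1 - r lowers the order of the negative binomial series by one, up
    to a boundary term that is nonnegative when [0 <= r]. *)
Lemma neg_binomial_sumS (r : R) k N :
  (1 - r) * \sum_(m < N) 'C(m + k.+1, k.+1)%:R * r ^+ m =
  \sum_(m < N) 'C(m + k, k)%:R * r ^+ m - 'C(N + k, k.+1)%:R * r ^+ N.
Proof.
elim: N => [|N IH].
  by rewrite !big_ord0 bin_small// mulr0 mul0r subr0.
rewrite !big_ord_recr /= mulrDr IH addnS addSn binS natrD exprS; ring.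
Qed.

(** The sum truncates the expansion of (1-r)^(-k-1), which has nonnegative terms. The induction on
    [k] drops the boundary term each time, so no infinite series occurs. *)
Lemma neg_binomial_sum_le1 (r : R) k N : 0 <= r <= 1 ->
  (1 - r) ^+ k.+1 * \sum_(m < N) 'C(m + k, k)%:R * r ^+ m <= 1.
Proof.
move=> /andP[r0 r1]; elim: k => [|k IH].
  rewrite expr1; elim: N => [|N IH]; first by rewrite big_ord0 mulr0.
  suff -> : (1 - r) * \sum_(m < N.+1) 'C(m + 0, 0)%:R * r ^+ m = 1 - r ^+ N.+1.
    by rewrite gerBl exprn_ge0.
  elim: {IH} N => [|N IH].
    by rewrite big_ord_recr big_ord0 /= bin0 expr0 expr1; ring.
  by rewrite big_ord_recr/= mulrDr IH bin0 [r ^+ N.+2]exprS; ring.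
apply: le_trans IH; rewrite exprSr -mulrA neg_binomial_sumS.
rewrite ler_wpM2l ?exprn_ge0 ?subr_ge0// gerBl.
by rewrite mulr_ge0 ?exprn_ge0.
Qed.

End negative_binomial.

Section basis.
Context {R : realType}.
Local Notation pm := (@plane_measure R).
Local Notation D := (@disk R : set (mplane R)).
Local Notation mu := (@mu R).

Definition mu_coef (i : nat) : R :=
  Num.sqrt ((2 * i.+1%:R ^+ 3 - 2 * i.+1%:R) / pi).

(** With n = m + 2, the factorisation 2n^3 - 2n = 2(n-1)n(n+1). *)
Lemma mu_coef2 m : mu_coef m.+1 ^+ 2 = 2 * (m.+1 * m.+2 * m.+3)%:R / pi.
Proof.
have e : 2 * m.+2%:R ^+ 3 - 2 * m.+2%:R = 2 * (m.+1 * m.+2 * m.+3)%:R :> R.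
  by rewrite !natrM -[m.+3]addn1 -[m.+2]addn1 -[m.+1]addn1 !natrD; ring.
by rewrite sqr_sqrtr e// divr_ge0 ?pi_ge0 ?mulr_ge0.
Qed.

Lemma muE i (p : R * R) : disk p -> mu i p =
  (mu_coef i / 4)%:C * ((conjc (toC p)) ^+ i.-1 * eval W p ^+ 2).
Proof.
move=> Dp; rewrite /mu mem_set// subSS subn1 eval_W.
set s := p.1 ^+ 2 + p.2 ^+ 2; set z := (conjc (toC p)) ^+ i.-1.
transitivity ((mu_coef i / 4 * (1 - s) ^+ 2)%:C * z).
  by congr (_%:C * _); rewrite /mu_coef; ring.
by rewrite rmorphM rmorphXn; ring.
Qed.

Lemma disk_W_gt0 (p : R * R) : disk p -> 0 < 1 - (p.1 ^+ 2 + p.2 ^+ 2).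
Proof. by rewrite subr_gt0. Qed.

Lemma rho_gt0 (p : R * R) : disk p -> 0 < rho p.
Proof. by move=> Dp; rewrite divr_gt0// exprn_gt0// disk_W_gt0. Qed.

Lemma W2_rho (p : R * R) : disk p -> eval W p ^+ 2 * (rho p)%:C = 4%:C.
Proof.
move=> Dp; rewrite eval_W -rmorphXn -rmorphM /rho mulrC divfK//.
by rewrite expf_neq0// gt_eqF// disk_W_gt0.
Qed.

Lemma mu_conj_mu i j (p : R * R) : disk p -> mu i p * conjc (mu j p) =
  (mu_coef i * mu_coef j / 16)%:C * eval (mono j.-1 i.-1 4) p.
Proof.
move=> Dp; rewrite !muE// eval_mono !conjcM !conjcX conjcK.
have -> : conjc (eval W p) = eval W p by rewrite eval_W conjc_real.
have -> : (mu_coef i * mu_coef j / 16)%:C =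
    (mu_coef i / 4)%:C * (mu_coef j / 4)%:C :> R[i].
  by rewrite -rmorphM; congr (_%:C); field.
rewrite conjc_real.
by ring.
Qed.

(** The density, which is unbounded on the disk, cancels two of the four powers of W and leaves a
    polynomial, so the pairings of the basis become moments. *)
Lemma mu_conj_mu_rho i j (p : R * R) : disk p ->
  mu i p * conjc (mu j p) * (rho p)%:C =
  (mu_coef i * mu_coef j / 4)%:C * eval (mono j.-1 i.-1 2) p.
Proof.
move=> Dp; rewrite mu_conj_mu// !eval_mono.
transitivity ((mu_coef i * mu_coef j / 16)%:C *
  (toC p ^+ j.-1 * ((conjc (toC p)) ^+ i.-1 * eval W p ^+ 2)) *
  (eval W p ^+ 2 * (rho p)%:C)); first by ring.
rewrite W2_rho// mulrAC -rmorphM; congr (_%:C * _).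
by field.
Qed.

Definition mu_conj_mu_exp i j :=
  Mul (Cst (mu_coef i * mu_coef j / 16)%:C) (mono j.-1 i.-1 4).

Lemma smooth_mu_conj_mu i j : smooth (fun p => mu i p * conjc (mu j p)).
Proof.
apply: (@smooth_eval_on_disk _ (mu_conj_mu_exp i j)) => p Dp.
by rewrite mu_conj_mu.
Qed.

Lemma bounded_mu_conj_mu i j :
  exists M : R, forall p, disk p -> normc (mu i p * conjc (mu j p)) <= M.
Proof.
have [M hM] := eval_bounded (mu_conj_mu_exp i j).
by exists M => p Dp; rewrite mu_conj_mu//; exact: hM.
Qed.

Lemma cintegrable_mu_conj_mu_rho i j :
  cintegrable pm D (fun p => mu i p * conjc (mu j p) * (rho p)%:C).
Proof.
apply: (eq_cintegrable _ _ (cintegrable_eval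
  (Mul (Cst (mu_coef i * mu_coef j / 4)%:C) (mono j.-1 i.-1 2)))).
  exact: measurable_disk.
by move=> p; rewrite inE => Dp; rewrite mu_conj_mu_rho.
Qed.

(** On the diagonal, with i = m + 1, the square of [mu_coef] over 4 meets the moment 2 area /
    ((m+1)(m+2)(m+3)), and the three integers cancel. *)
Lemma gram i j : (0 < i)%N -> (0 < j)%N ->
  cintegral pm D (fun p => mu i p * conjc (mu j p) * (rho p)%:C) =
  (if i == j then @area R / pi else 0)%:C.
Proof.
move=> i0 j0.
transitivity ((mu_coef i * mu_coef j / 4)%:C * moment j.-1 i.-1 2 : R[i]).
  rewrite -(cintegralZ measurable_disk); last exact: cintegrable_eval.
  by apply: eq_cintegral => p; rewrite inE => Dp; rewrite mu_conj_mu_rho.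
case: eqVneq => [<-|ij]; last first.
  rewrite moment_off ?mulr0//; apply: contra_neq ij => h.
  by rewrite -(prednK i0) -(prednK j0) h.
case: i i0 {j0} => // m _; rewrite /= -expr2 mu_coef2.
have nz : ((m.+1 * m.+2 * m.+3)%:R : R[i]) != 0 by rewrite pnatr_eq0 !muln_eq0.
apply: (mulfI nz); rewrite mulrCA moment_diag2 moment000.
set N := (_ * _ * _)%N.
have -> : N%:R = (N%:R)%:C :> R[i] by rewrite rmorph_nat.
have -> : 2 = 2%:C :> R[i] by rewrite rmorph_nat.
have : (pi : R) != 0 by rewrite gt_eqF// pi_gt0.
rewrite -!rmorphM => pi0; congr (_%:C); move: (pi : R) pi0 => P P0.
by field.
Qed.

Lemma H11_scale_mu (c : R[i]) i : H11 (fun p => c * mu i p).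
Proof.
(* An element of [H11] is conj(q)/rho, so [q] carries the conjugate of [c]; the factor W^2/4 in
   [mu i] is 1/rho. *)
exists (fun z => conjc c * (mu_coef i)%:C * z ^+ i.-1); split.
- move=> p Dp.
  rewrite (_ : (fun z => _) = cst (conjc c * (mu_coef i)%:C) *
      ((id : R[i]^o -> R[i]^o) ^+ i.-1) :> (R[i]^o -> R[i]^o)).
    by apply: derivableM; [exact: derivable_cst|exact/derivableX/derivable_id].
  by apply/funext => z; rewrite !fctE.
- pose A := conjc c * (mu_coef i)%:C.
  pose e := Mul (Cst (normc A ^+ 2 / 4)%:C) (mono i.-1 i.-1 2).
  apply: le_lt_trans (integrable_lty measurable_disk (cintegrable_eval e).1).
  rewrite le_eqVlt; apply/orP; left; apply/eqP.
  apply: eq_integral => p; rewrite inE => Dp; congr EFin.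
  rewrite /comp (_ : eval e p = (normc A ^+ 2 / 4)%:C *
    eval (mono i.-1 i.-1 2) p)// eval_mono eval_W.
  rewrite mulrA -exprMn normcC -!rmorphXn -!rmorphM Normc.normcM exprMn.
  by rewrite normcX /rho invf_div exprAC /=; ring.
- apply/funext => p; rewrite in_disk; case: ifP => [Dp|/negbT Dp].
    rewrite muE// conjE !conjcM conjcK conjc_real conjcX.
    have r0 : (rho p)%:C != 0 :> R[i].
      by rewrite fmorph_eq0 gt_eqF// rho_gt0.
    have h4 : (4 : R[i]) != 0 by rewrite pnatr_eq0.
    have -> : eval W p ^+ 2 = 4 / (rho p)%:C.
      by apply: (mulIf r0); rewrite W2_rho// divfK// rmorph_nat.
    have -> : (mu_coef i / 4)%:C = (mu_coef i)%:C / 4 :> R[i].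
      by rewrite rmorphM fmorphV rmorph_nat.
    by field.
  by rewrite /mu memNset ?mulr0//; apply/negP.
Qed.

(** The sum truncates the reproducing kernel on the diagonal. The untruncated kernel is constant:
    its series sums to (1-r)^(-4) and meets the factor (1-r)^4. *)
Lemma mu_kernel_le N (p : R * R) : disk p ->
  \sum_(i <- iota 1 N) normc (mu i p) ^+ 2 <= 3 / (4 * pi).
Proof.
move=> Dp; set r := p.1 ^+ 2 + p.2 ^+ 2.
have r01 : 0 <= r <= 1 by rewrite addr_ge0 ?sqr_ge0//= ltW.
rewrite (iotaDl 1 0) big_map -[N in iota 0 N]subn0 -/(index_iota 0 N) big_mkord.
(* The coefficient is 2(m+1)(m+2)(m+3)/(16 pi), that is 12 'C(m+3, 3)/(16 pi). *)
have -> : \sum_(i < N) normc (mu (1 + i) p) ^+ 2 = 3 / (4 * pi) *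
    ((1 - r) ^+ 4 * \sum_(m < N) 'C(m + 3, 3)%:R * r ^+ m).
  rewrite !mulr_sumr; apply: eq_bigr => m _; rewrite add1n muE// eval_W.
  rewrite !Normc.normcM !normcX normc_conj !normc_real !exprMn.
  rewrite real_normK ?num_real// exprMn mu_coef2.
  have -> : 'C(m + 3, 3)%:R = (m.+1 * m.+2 * m.+3)%:R / 6 :> R.
    have := bin_ffact (m + 3) 3; rewrite !ffactnS ffactn0 addn3 /=.
    by move=> /(congr1 (fun n => n%:R : R)); rewrite !natrM => h; lra.
  have -> : normc (toC p) ^+ m ^+ 2 = r ^+ m by rewrite exprAC sqr_normcE.
  rewrite -/r real_normK ?num_real//.
  have : (pi : R) != 0 by rewrite gt_eqF// pi_gt0.
  by move: (pi : R) => P P0; field.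
rewrite ler_piMr ?neg_binomial_sum_le1//.
by rewrite divr_ge0// mulr_ge0// pi_ge0.
Qed.

End basis.

(** * Integration against the Green function *)

Section fubini_on.
Context d1 d2 (T1 : measurableType d1) (T2 : measurableType d2) (R : realType).
Variable m1 : {sigma_finite_measure set T1 -> \bar R}.
Variable m2 : {sigma_finite_measure set T2 -> \bar R}.
Variables (A1 : set T1) (A2 : set T2).
Hypotheses (mA1 : measurable A1) (mA2 : measurable A2).
Local Open Scope ereal_scope.
Implicit Type f : T1 * T2 -> \bar R.

Lemma fubini_F_patch f : fubini_F m2 (f \_ (A1 `*` A2)) =
  (fun x => \int[m2]_(y in A2) f (x, y)) \_ A1.
Proof.
apply/funext => x; rewrite /fubini_F patchE.
have [xA|xA] := boolP (x \in A1).
  rewrite [RHS]integral_mkcond; apply: eq_integral => y _.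
  by rewrite !patchE in_setX xA.
by apply: integral0_eq => y _; rewrite patchE in_setX (negPf xA).
Qed.

Lemma fubini_G_patch f : fubini_G m1 (f \_ (A1 `*` A2)) =
  (fun y => \int[m1]_(x in A1) f (x, y)) \_ A2.
Proof.
apply/funext => y; rewrite /fubini_G patchE.
have [yA|yA] := boolP (y \in A2).
  rewrite [RHS]integral_mkcond; apply: eq_integral => x _.
  by rewrite !patchE in_setX yA andbT.
by apply: integral0_eq => x _; rewrite patchE in_setX (negPf yA) andbF.
Qed.

Lemma tonelli_on1 f : measurable_fun (A1 `*` A2) f ->
  (forall x, (A1 `*` A2) x -> 0 <= f x) ->
  \int[m1 \x m2]_(z in A1 `*` A2) f z =
  \int[m1]_(x in A1) \int[m2]_(y in A2) f (x, y).
Proof.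
move=> mf f0; rewrite integral_mkcond fubini_tonelli1.
- by rewrite fubini_F_patch -integral_mkcond.
- by apply/(measurable_restrictT _ _).1 => //; exact: measurableX.
- by move=> z; rewrite patchE; case: ifPn => //; rewrite inE; exact: f0.
Qed.

Lemma tonelli_on2 f : measurable_fun (A1 `*` A2) f ->
  (forall x, (A1 `*` A2) x -> 0 <= f x) ->
  \int[m1 \x m2]_(z in A1 `*` A2) f z =
  \int[m2]_(y in A2) \int[m1]_(x in A1) f (x, y).
Proof.
move=> mf f0; rewrite integral_mkcond fubini_tonelli2.
- by rewrite fubini_G_patch -integral_mkcond.
- by apply/(measurable_restrictT _ _).1 => //; exact: measurableX.
- by move=> z; rewrite patchE; case: ifPn => //; rewrite inE; exact: f0.
Qed.

Lemma fubini_on f : (m1 \x m2).-integrable (A1 `*` A2) f ->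
  m1.-integrable A1 (fun x => \int[m2]_(y in A2) f (x, y)) /\
  \int[m1 \x m2]_(z in A1 `*` A2) f z =
  \int[m1]_(x in A1) \int[m2]_(y in A2) f (x, y).
Proof.
move=> intf.
have intfp : (m1 \x m2).-integrable setT (f \_ (A1 `*` A2)).
  exact: (integrable_mkcond (mu := m1 \x m2) f (measurableX mA1 mA2)).1.
have := integrable_fubini_F intfp; have := integral12_prod_meas1 intfp.
rewrite fubini_F_patch -!integral_mkcond => <- h; split => //.
exact: (integrable_mkcond (mu := m1) _ mA1).2.
Qed.

End fubini_on.

Section green.
Context {R : realType}.
Local Notation pm := (@plane_measure R).
Local Notation D := (@disk R : set (mplane R)).
Local Notation m2 := (@plane_measure R \x @plane_measure R)%E.
Variables (G : R * R -> R * R -> R) (hG : green_function G).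

Lemma measurable_rho : measurable_fun D (@rho R).
Proof.
have mf : measurable_fun D (fun p => p.1 ^+ 2 + p.2 ^+ 2).
  apply: measurable_funTS; apply: measurable_funD; apply: measurable_funX.
    exact: measurable_fst.
  exact: measurable_snd.
rewrite (_ : @rho R = (fun t => 4 / (1 - t) ^+ 2) \o
  (fun p => p.1 ^+ 2 + p.2 ^+ 2))//.
have o1 : open [set t : R | t < 1] by exact: open_lt.
apply: (@measurable_comp _ _ _ _ _ _ [set t : R | t < 1]) mf => //.
- exact: open_measurable.
- by move=> _ [p Dp <-].
apply: open_continuous_measurable_fun => // t; rewrite inE /= => t1.
have nz : (1 - t) ^+ 2 != 0 by rewrite expf_neq0// gt_eqF// subr_gt0.
apply: cvgM; first exact: cvg_cst.
apply: cvgV => //; apply: cvgM; (apply: cvgB; [exact: cvg_cst|exact: cvg_id]).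
Qed.

Let mD : measurable D := measurable_disk.
Let mD2 : measurable (D `*` D) := measurableX mD mD.

Lemma measurable_on_fst (f : mplane R -> R) : measurable_fun D f ->
  measurable_fun (D `*` D) (fun zw => f zw.1).
Proof.
move=> mf; apply: (measurable_comp mD _ mf) => //.
  by move=> _ [[z w] [Dz _] <-].
by apply: measurable_funTS; exact: measurable_fst.
Qed.

Lemma measurable_on_snd (f : mplane R -> R) : measurable_fun D f ->
  measurable_fun (D `*` D) (fun zw => f zw.2).
Proof.
move=> mf; apply: (measurable_comp mD _ mf) => //.
  by move=> _ [[z w] [_ Dw] <-].
by apply: measurable_funTS; exact: measurable_snd.
Qed.

Let mG : measurable_fun (D `*` D) (fun zw : mplane R * mplane R => G zw.1 zw.2).
Proof. by case: hG. Qed.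

Lemma rho_ge0 (p : R * R) : disk p -> 0 <= rho p.
Proof. by move=> /rho_gt0 /ltW. Qed.

Lemma G_ge0 z w : disk z -> disk w -> 0 <= G z w.
Proof. by move=> Dz Dw; case: hG => _ h _ _ _; exact/ltW/h. Qed.

Lemma measurable_G_slice z : disk z ->
  measurable_fun D (fun w => G z w * rho w).
Proof.
move=> Dz; apply: measurable_funM; last exact: measurable_rho.
apply: (@measurable_comp _ _ _ _ _ _ _ _ _ (fun w : mplane R => (z, w)) mD2 _ mG).
  by move=> _ [w Dw <-].
by apply: measurable_funTS; exact: pair1_measurable.
Qed.

Lemma integrable_G_slice z : disk z ->
  pm.-integrable D (EFin \o (fun w => G z w * rho w)).
Proof.
move=> Dz; apply/integrableP; split.
  by apply/measurable_EFinP; exact: measurable_G_slice.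
case: hG => _ _ _ /(_ z Dz) h _; apply: le_lt_trans (ltry 1).
rewrite -h le_eqVlt; apply/orP; left; apply/eqP.
apply: eq_integral => w; rewrite inE => Dw /=.
by rewrite ger0_norm// mulr_ge0 ?G_ge0 ?rho_ge0.
Qed.

Lemma green_mass1 (g : mplane R -> R) :
  pm.-integrable D (EFin \o g) -> (forall z, disk z -> 0 <= g z) ->
  m2.-integrable (D `*` D)
    (EFin \o (fun zw => G zw.1 zw.2 * rho zw.2 * g zw.1)) /\
  (\int[m2]_(zw in D `*` D) (G zw.1 zw.2 * rho zw.2 * g zw.1)%:E =
  \int[pm]_(z in D) (g z)%:E)%E.
Proof.
move=> ig g0; have /measurable_EFinP mg := measurable_int _ ig.
have mK : measurable_fun (D `*` D) (fun zw : mplane R * mplane R =>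
    G zw.1 zw.2 * rho zw.2 * g zw.1).
  apply: measurable_funM; last exact: measurable_on_fst.
  by apply: measurable_funM => //; exact: measurable_on_snd measurable_rho.
have K0 (zw : mplane R * mplane R) : (D `*` D) zw ->
    0 <= G zw.1 zw.2 * rho zw.2 * g zw.1.
  by move=> [Dz Dw]; rewrite mulr_ge0 ?g0// mulr_ge0 ?G_ge0 ?rho_ge0.
have E : (\int[m2]_(zw in D `*` D) (G zw.1 zw.2 * rho zw.2 * g zw.1)%:E =
    \int[pm]_(z in D) (g z)%:E)%E.
  rewrite tonelli_on1//; last exact/measurable_EFinP.
  apply: eq_integral => z; rewrite inE => Dz /=.
  under eq_integral do rewrite EFinM.
  rewrite ge0_integralZr//.
  - by case: hG => _ _ _ -> // _; rewrite mul1e.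
  - by apply/measurable_EFinP; exact: measurable_G_slice.
  - by move=> w Dw; rewrite lee_fin mulr_ge0 ?G_ge0 ?rho_ge0.
  - by rewrite lee_fin g0.
split => //; apply/integrableP; split; first exact/measurable_EFinP.
apply: (@le_lt_trans _ _ (\int[pm]_(z in D) (g z)%:E)%E).
  rewrite -E le_eqVlt; apply/orP; left; apply/eqP.
  apply: eq_integral => zw; rewrite inE => Dzw /=.
  by rewrite ger0_norm// K0.
exact: integrable_lty.
Qed.

(** [green_function] gives total mass one in the second variable only; the symmetry of [G] transfers
    it to the first. *)
Lemma green_mass2 (g : mplane R -> R) :
  pm.-integrable D (EFin \o g) -> (forall z, disk z -> 0 <= g z) ->
  m2.-integrable (D `*` D)
    (EFin \o (fun zw => G zw.1 zw.2 * rho zw.1 * g zw.2)) /\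
  (\int[m2]_(zw in D `*` D) (G zw.1 zw.2 * rho zw.1 * g zw.2)%:E =
  \int[pm]_(z in D) (g z)%:E)%E.
Proof.
move=> ig g0; have /measurable_EFinP mg := measurable_int _ ig.
have mK : measurable_fun (D `*` D) (fun zw : mplane R * mplane R =>
    G zw.1 zw.2 * rho zw.1 * g zw.2).
  apply: measurable_funM; last exact: measurable_on_snd.
  by apply: measurable_funM => //; exact: measurable_on_fst measurable_rho.
have K0 (zw : mplane R * mplane R) : (D `*` D) zw ->
    0 <= G zw.1 zw.2 * rho zw.1 * g zw.2.
  by move=> [Dz Dw]; rewrite mulr_ge0 ?g0// mulr_ge0 ?G_ge0 ?rho_ge0.
have E : (\int[m2]_(zw in D `*` D) (G zw.1 zw.2 * rho zw.1 * g zw.2)%:E =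
    \int[pm]_(z in D) (g z)%:E)%E.
  rewrite tonelli_on2//; last exact/measurable_EFinP.
  apply: eq_integral => w; rewrite inE => Dw /=.
  transitivity (\int[pm]_(z in D) ((G w z * rho z)%:E * (g w)%:E))%E.
    apply: eq_integral => z; rewrite inE => Dz; rewrite EFinM.
    by case: hG => _ _ -> .
  rewrite ge0_integralZr//.
  - by case: hG => _ _ _ -> // _; rewrite mul1e.
  - by apply/measurable_EFinP; exact: measurable_G_slice.
  - by move=> z Dz; rewrite lee_fin mulr_ge0 ?G_ge0 ?rho_ge0.
  - by rewrite lee_fin g0.
split => //; apply/integrableP; split; first exact/measurable_EFinP.
apply: (@le_lt_trans _ _ (\int[pm]_(z in D) (g z)%:E)%E).
  rewrite -E le_eqVlt; apply/orP; left; apply/eqP.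
  apply: eq_integral => zw; rewrite inE => Dzw /=.
  by rewrite ger0_norm// K0.
exact: integrable_lty.
Qed.

(** Fubini applies because the integrand is dominated by G rho M |b|, integrable by [green_mass1].
    The density of the variable z is meant to be contained in [b]. *)
Lemma green_bilinear (a b : mplane R -> R) (M : R) :
  measurable_fun D a -> (forall w, disk w -> `|a w| <= M) ->
  pm.-integrable D (EFin \o b) ->
  [/\ m2.-integrable (D `*` D)
        (EFin \o (fun zw => G zw.1 zw.2 * rho zw.2 * a zw.2 * b zw.1)),
      pm.-integrable D (EFin \o
        (fun z => (\int[pm]_(w in D) (G z w * rho w * a w)) * b z)) &
      \int[m2]_(zw in D `*` D)
        (G zw.1 zw.2 * rho zw.2 * a zw.2 * b zw.1) =
      \int[pm]_(z in D) ((\int[pm]_(w in D) (G z w * rho w * a w)) * b z)].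
Proof.
move=> ma aM ib; have /measurable_EFinP mb := measurable_int _ ib.
have M0 : 0 <= M.
  have D0 : disk (0 : R * R) by rewrite /disk/= expr0n addr0.
  exact: le_trans (normr_ge0 _) (aM _ D0).
have iK : m2.-integrable (D `*` D)
    (EFin \o (fun zw => G zw.1 zw.2 * rho zw.2 * a zw.2 * b zw.1)).
  have [iMb _] := @green_mass1 (fun z => M * `|b z|)
    (integrableZE mD M (integrable_norm ib)) (fun z _ => mulr_ge0 M0 (normr_ge0 _)).
  apply: le_integrable iMb => //.
    apply/measurable_EFinP; apply: measurable_funM; last exact: measurable_on_fst.
    apply: measurable_funM; last exact: measurable_on_snd.
    by apply: measurable_funM => //; exact: measurable_on_snd measurable_rho.
  move=> [z w] [Dz Dw] /=; rewrite lee_fin !normrM normr_id -!mulrA.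
  rewrite !ler_wpM2l ?normr_ge0// ler_wpM2r// (le_trans (aM w Dw))//.
  exact: ler_norm.
have inner z : disk z -> (\int[pm]_(w in D) (G z w * rho w * a w * b z)%:E =
    ((\int[pm]_(w in D) (G z w * rho w * a w)) * b z)%:E)%E.
  move=> Dz.
  have ia : pm.-integrable D (EFin \o (fun w => G z w * rho w * a w)).
    have := integrableZE mD M (integrable_G_slice Dz).
    apply: le_integrable => //.
      apply/measurable_EFinP; apply: measurable_funM => //.
      exact: measurable_G_slice.
    move=> w Dw /=; rewrite lee_fin normrM [`|M * _|]normrM mulrC ler_wpM2r//.
    exact: le_trans (aM w Dw) (ler_norm _).
  rewrite EFinM /Rintegral fineK; last exact: integrable_fin_num.
  by rewrite -integralZr//; apply: eq_integral => w _; rewrite EFinM.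
have [i1 e1] := fubini_on mD mD iK.
split => //.
  apply: eq_integrable i1 => // z; rewrite inE => Dz; exact: inner.
rewrite [LHS]/Rintegral e1; congr fine; apply: eq_integral => z; rewrite inE => Dz.
exact: inner.
Qed.

End green.

Section green_complex.
Context {R : realType}.
Local Notation pm := (@plane_measure R).
Local Notation D := (@disk R : set (mplane R)).
Local Notation m2 := (@plane_measure R \x @plane_measure R)%E.
Variables (G : R * R -> R * R -> R) (hG : green_function G).
Let mD : measurable D := measurable_disk.
Let mD2 : measurable (D `*` D) := measurableX mD mD.

Lemma intdAE (f : R * R -> R[i]) :
  intdA f = cintegral pm D (fun p => f p * (rho p)%:C).
Proof.
by congr Complex; apply: eq_Rintegral => p _; rewrite ?ReMr ?ImMr.
Qed.

Lemma eq_intdA (f g : R * R -> R[i]) : (forall p, disk p -> f p = g p) ->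
  intdA f = intdA g.
Proof.
by move=> fg; rewrite !intdAE; apply: eq_cintegral => p; rewrite inE => /fg ->.
Qed.

Definition green_kernel (phi beta : R * R -> R[i])
    (zw : mplane R * mplane R) : R[i] :=
  (G zw.1 zw.2 * rho zw.2)%:C * phi zw.2 * beta zw.1.

Lemma green_cbilinear (phi beta : mplane R -> R[i]) (M : R) :
  measurable_fun D (Re \o phi) -> measurable_fun D (Im \o phi) ->
  (forall w, disk w -> normc (phi w) <= M) -> cintegrable pm D beta ->
  cintegrable m2 (D `*` D) (green_kernel phi beta) /\
  cintegral m2 (D `*` D) (green_kernel phi beta) =
  cintegral pm D (fun z =>
    cintegral pm D (fun w => (G z w * rho w)%:C * phi w) * beta z).
Proof.
move=> mR mI bM [iR iI].
have bR w : disk w -> `|(Re \o phi) w| <= M.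
  by move=> Dw; exact: le_trans (normc_ge_Re _) (bM w Dw).
have bI w : disk w -> `|(Im \o phi) w| <= M.
  by move=> Dw; exact: le_trans (normc_ge_Im _) (bM w Dw).
have [iRR jRR eRR] := green_bilinear hG mR bR iR.
have [iRI jRI eRI] := green_bilinear hG mR bR iI.
have [iIR jIR eIR] := green_bilinear hG mI bI iR.
have [iII jII eII] := green_bilinear hG mI bI iI.
have kR zw : Re (green_kernel phi beta zw) =
    G zw.1 zw.2 * rho zw.2 * (Re \o phi) zw.2 * (Re \o beta) zw.1 -
    G zw.1 zw.2 * rho zw.2 * (Im \o phi) zw.2 * (Im \o beta) zw.1.
  by rewrite /green_kernel [_%:C * _]mulrC ReM ReMr ImMr /=; ring.
have kI zw : Im (green_kernel phi beta zw) =
    G zw.1 zw.2 * rho zw.2 * (Re \o phi) zw.2 * (Im \o beta) zw.1 +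
    G zw.1 zw.2 * rho zw.2 * (Im \o phi) zw.2 * (Re \o beta) zw.1.
  by rewrite /green_kernel [_%:C * _]mulrC ImM ReMr ImMr /=; ring.
split.
  split.
    apply: eq_integrable (integrableB mD2 iRR iII) => // zw _ /=.
    by rewrite kR EFinB.
  apply: eq_integrable (integrableD mD2 iRI iIR) => // zw _ /=.
  by rewrite kI EFinD.
have cRe z : Re (cintegral pm D (fun w => (G z w * rho w)%:C * phi w)) =
    \int[pm]_(w in D) (G z w * rho w * (Re \o phi) w).
  by apply: eq_Rintegral => w _; rewrite mulrC ReMr mulrC.
have cIm z : Im (cintegral pm D (fun w => (G z w * rho w)%:C * phi w)) =
    \int[pm]_(w in D) (G z w * rho w * (Im \o phi) w).
  by apply: eq_Rintegral => w _; rewrite mulrC ImMr mulrC.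
apply/eqP; rewrite eq_complex; apply/andP; split; apply/eqP.
  transitivity (\int[m2]_(zw in D `*` D)
    (G zw.1 zw.2 * rho zw.2 * (Re \o phi) zw.2 * (Re \o beta) zw.1 -
     G zw.1 zw.2 * rho zw.2 * (Im \o phi) zw.2 * (Im \o beta) zw.1)).
    by apply: eq_Rintegral => zw _; exact: kR.
  rewrite RintegralB// eRR eII -RintegralB//.
  by apply: eq_Rintegral => z _; rewrite ReM cRe cIm.
transitivity (\int[m2]_(zw in D `*` D)
  (G zw.1 zw.2 * rho zw.2 * (Re \o phi) zw.2 * (Im \o beta) zw.1 +
   G zw.1 zw.2 * rho zw.2 * (Im \o phi) zw.2 * (Re \o beta) zw.1)).
  by apply: eq_Rintegral => zw _; exact: kI.
rewrite RintegralD// eRI eIR -RintegralD//.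
by apply: eq_Rintegral => z _; rewrite ImM cRe cIm.
Qed.

(* Schur's test: the Green function has total mass one in each variable. *)
Lemma green_schur (I : Type) (s : seq I) (a : I -> R[i])
    (phi psi : I -> mplane R -> R[i]) (h k : mplane R -> R) :
  (forall i, measurable_fun D (Re \o phi i)) ->
  (forall i, measurable_fun D (Im \o phi i)) ->
  (forall i, exists M : R, forall w, disk w -> normc (phi i w) <= M) ->
  (forall i, cintegrable pm D (fun z => psi i z * (rho z)%:C)) ->
  (forall p, disk p -> 0 <= h p) -> (forall p, disk p -> 0 <= k p) ->
  pm.-integrable D (EFin \o (fun p => h p * rho p)) ->
  pm.-integrable D (EFin \o (fun p => k p * rho p)) ->
  (forall z w, disk z -> disk w ->
    normc (\sum_(i <- s) a i * (phi i w * psi i z)) <= h w + k z) ->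
  normc (\sum_(i <- s) a i *
    intdA (fun z => intdA (fun w => (G z w)%:C * phi i w) * psi i z)) <=
  \int[pm]_(p in D) (h p * rho p) + \int[pm]_(p in D) (k p * rho p).
Proof.
move=> mR mI bphi ipsi h0 k0 ih ik dom.
pose beta i z := psi i z * (rho z)%:C.
have cb i : cintegrable m2 (D `*` D) (green_kernel (phi i) (beta i)) /\
    cintegral m2 (D `*` D) (green_kernel (phi i) (beta i)) =
    intdA (fun z => intdA (fun w => (G z w)%:C * phi i w) * psi i z).
  have [M hM] := bphi i; have [i1 e1] := green_cbilinear (mR i) (mI i) hM (ipsi i).
  split=> //; rewrite e1 intdAE; apply: eq_cintegral => z _.
  rewrite intdAE /beta mulrA; congr (_ * _ * _); apply: eq_cintegral => w _.
  by rewrite rmorphM mulrAC.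
(* The whole sum goes under one double integral before any modulus is taken: [dom] controls the sum,
   not its terms. *)
have -> : \sum_(i <- s) a i *
      intdA (fun z => intdA (fun w => (G z w)%:C * phi i w) * psi i z) =
    cintegral m2 (D `*` D)
      (fun zw => \sum_(i <- s) a i * green_kernel (phi i) (beta i) zw).
  rewrite cintegral_sum//; last first.
    by move=> i; apply: cintegrableZ => //; exact: (cb i).1.
  by apply: eq_bigr => i _; rewrite cintegralZ ?(cb i).2//; exact: (cb i).1.
(* For the part depending on z the variable w is integrated out first, and conversely; each time [G]
   disappears with mass one. *)
have [i1 e1] := green_mass1 hG ik (fun p Dp => mulr_ge0 (k0 p Dp) (rho_ge0 Dp)).
have [i2 e2] := green_mass2 hG ih (fun p Dp => mulr_ge0 (h0 p Dp) (rho_ge0 Dp)).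
rewrite addrC /(\int[pm]_(p in D) (k p * rho p)) /(\int[pm]_(p in D) (h p * rho p)).
rewrite /Rintegral -e1 -e2 -!/(Rintegral _ _ _) -RintegralD//.
apply: normc_cintegral_le => //.
- by apply: cintegrable_sum => // i; apply: cintegrableZ => //; exact: (cb i).1.
- by apply: eq_integrable (integrableD mD2 i1 i2).
move=> [z w] [/= Dz Dw].
have -> : \sum_(i <- s) a i * green_kernel (phi i) (beta i) (z, w) =
    (G z w * rho w * rho z)%:C * \sum_(i <- s) a i * (phi i w * psi i z).
  rewrite mulr_sumr; apply: eq_bigr => i _; rewrite /green_kernel /beta /=.
  by rewrite [in RHS]rmorphM; ring.
have K0 : 0 <= G z w * rho w * rho z.
  by rewrite mulr_ge0 ?rho_ge0// mulr_ge0 ?rho_ge0 ?(G_ge0 hG).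
rewrite Normc.normcM normc_real ger0_norm//.
apply: le_trans (ler_wpM2l K0 (dom z w Dz Dw)) _.
by rewrite le_eqVlt; apply/orP; left; apply/eqP; ring.
Qed.

End green_complex.

(** * The curvature form *)

Section cauchy_schwarz.
Context {R : realType}.

Lemma cauchy_schwarz (I : Type) (s : seq I) (a b : I -> R) :
  (\sum_(i <- s) a i * b i) ^+ 2 <=
  (\sum_(i <- s) a i ^+ 2) * (\sum_(i <- s) b i ^+ 2).
Proof.
elim: s => [|i s IH]; first by rewrite !big_nil expr0n mulr0.
rewrite !big_cons; move: IH.
set S := \sum_(j <- s) a j * b j; set A := \sum_(j <- s) a j ^+ 2.
set B := \sum_(j <- s) b j ^+ 2 => IH.
have A0 : 0 <= A by apply: sumr_ge0 => j _; exact: sqr_ge0.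
have B0 : 0 <= B by apply: sumr_ge0 => j _; exact: sqr_ge0.
suff : 2 * (a i * b i * S) <= a i ^+ 2 * B + b i ^+ 2 * A by nra.
have h : `|S| <= Num.sqrt A * Num.sqrt B.
  by rewrite -sqrtrM// -sqrtr_sqr ler_sqrt// mulr_ge0.
rewrite -(sqr_sqrtr A0) -(sqr_sqrtr B0); move: (sqrtr_ge0 A) (sqrtr_ge0 B) h.
move: (Num.sqrt A) (Num.sqrt B) => x y x0 y0 h.
apply: (@le_trans _ _ (2 * (`|a i| * y) * (`|b i| * x))).
  apply: le_trans (ler_norm _) _; rewrite !normrM ger0_norm//.
  have := ler_wpM2l (mulr_ge0 (normr_ge0 (a i)) (normr_ge0 (b i))) h; lra.
rewrite -[a i ^+ 2]real_normK ?num_real// -[b i ^+ 2]real_normK ?num_real//.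
have := sqr_ge0 (`|a i| * y - `|b i| * x); lra.
Qed.

Lemma normc_cauchy_schwarz (I : Type) (s : seq I) (a b : I -> R[i]) :
  normc (\sum_(i <- s) a i * b i) ^+ 2 <=
  (\sum_(i <- s) normc (a i) ^+ 2) * (\sum_(i <- s) normc (b i) ^+ 2).
Proof.
apply: le_trans (cauchy_schwarz s (normc \o a) (normc \o b)).
have := normc_sum s xpredT (fun i => a i * b i).
under [X in _ <= X]eq_bigr do rewrite Normc.normcM.
by move=> h; rewrite lerXn2r ?nnegrE ?normc_ge0 ?(le_trans (normc_ge0 _) h).
Qed.

End cauchy_schwarz.

Section curvature_form.
Context {R : realType}.
Local Notation pm := (@plane_measure R).
Local Notation D := (@disk R : set (mplane R)).
Local Notation mu := (@mu R).
Implicit Types (c d : nat * nat -> R[i]) (N : nat).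
Let mD : measurable D := measurable_disk.

Definition square_idx N : seq (nat * nat) :=
  [seq (i, j) | i <- iota 1 N, j <- iota 1 N].

Definition kform c N (w z : R * R) : R[i] :=
  \sum_(x <- square_idx N) c x * (mu x.1 w * conjc (mu x.2 z)).

(** The function h of the overview, truncated at [N], as [kform] is F. *)
Definition kcol c N (w : R * R) : R :=
  \sum_(j <- iota 1 N) normc (\sum_(i <- iota 1 N) c (i, j) * mu i w) ^+ 2.

Definition csq c N : R := \sum_(x <- square_idx N) normc (c x) ^+ 2.

Lemma sum_square_idx (V : nmodType) (f : nat * nat -> V) N :
  \sum_(x <- square_idx N) f x =
  \sum_(i <- iota 1 N) \sum_(j <- iota 1 N) f (i, j).
Proof. by rewrite big_allpairs_dep. Qed.

Lemma kcol_ge0 c N w : 0 <= kcol c N w.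
Proof. by apply: sumr_ge0 => j _; exact: sqr_ge0. Qed.

Lemma csq_ge0 c N : 0 <= csq c N.
Proof. by apply: sumr_ge0 => j _; exact: sqr_ge0. Qed.

(** Cauchy-Schwarz in the index [j] alone: the factor in z is the kernel sum, bounded uniformly, and
    the sums over [i] stay intact for Parseval in [kcol_integral]. *)
Lemma kform_le c N (w z : R * R) : disk z ->
  normc (kform c N w z) ^+ 2 <= 3 / (4 * pi) * kcol c N w.
Proof.
move=> Dz; rewrite /kform sum_square_idx exchange_big/=.
under eq_bigr do (under eq_bigr do rewrite mulrA; rewrite -mulr_suml).
apply: le_trans (normc_cauchy_schwarz _ _ _) _.
rewrite mulrC ler_wpM2r ?kcol_ge0//.
under eq_bigr do rewrite normc_conj.
exact: mu_kernel_le.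
Qed.

Lemma sum_kronecker (s : seq nat) (f : nat -> R[i]) (x : R[i]) i :
  uniq s -> i \in s -> \sum_(k <- s) f k * (if i == k then x else 0) = f i * x.
Proof.
move=> us si; rewrite (bigD1_seq i)//= eqxx big1 ?addr0// => k ki.
by rewrite eq_sym (negPf ki) mulr0.
Qed.

(** Parseval: expanding the squared modulus gives a triple sum, of which [gram] keeps the terms with
    [k = i]. *)
Lemma kcol_integral c N :
  pm.-integrable D (EFin \o (fun w => kcol c N w * rho w)) /\
  \int[pm]_(w in D) (kcol c N w * rho w) = @area R / pi * csq c N.
Proof.
pose f j i k (w : mplane R) :=
  c (i, j) * conjc (c (k, j)) * (mu i w * conjc (mu k w) * (rho w)%:C).
pose F w := \sum_(j <- iota 1 N) \sum_(i <- iota 1 N) \sum_(k <- iota 1 N) f j i k w.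
have FE w : (kcol c N w * rho w)%:C = F w.
  rewrite rmorphM /kcol rmorph_sum mulr_suml; apply: eq_bigr => j _ /=.
  rewrite -normcC conjc_sum big_distrlr/= mulr_suml; apply: eq_bigr => i _.
  rewrite mulr_suml; apply: eq_bigr => k _; rewrite conjcM /f; ring.
have ci j i k : cintegrable pm D (f j i k).
  by apply: cintegrableZ => //; exact: cintegrable_mu_conj_mu_rho.
have ciF : cintegrable pm D F.
  by do 3 (apply: cintegrable_sum => // ?).
have EF : cintegral pm D F = (@area R / pi * csq c N)%:C.
  rewrite cintegral_sum//; last by move=> j; do 2 (apply: cintegrable_sum => // ?).
  rewrite rmorphM /csq sum_square_idx exchange_big/= rmorph_sum mulr_sumr.
  apply: eq_bigr => j _; rewrite rmorph_sum mulr_sumr.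
  rewrite cintegral_sum//; last by move=> i; apply: cintegrable_sum => // ?.
  rewrite !big_seq; apply: eq_bigr => i ii; rewrite cintegral_sum//.
  transitivity (\sum_(k <- iota 1 N) c (i, j) * conjc (c (k, j)) *
      (if i == k then (@area R / pi)%:C else 0)).
    rewrite !big_seq; apply: eq_bigr => k ik.
    rewrite cintegralZ//; last exact: cintegrable_mu_conj_mu_rho.
    move: ii ik; rewrite !mem_iota => /andP[i0 _] /andP[k0 _].
    by rewrite gram//; case: ifP.
  by rewrite sum_kronecker ?iota_uniq// normcC mulrC.
split.
  by apply: eq_integrable ciF.1 => // w _ /=; rewrite -FE.
have := congr1 Re EF; rewrite /= => <-; apply: eq_Rintegral => w _.
by rewrite -FE.
Qed.

Variables (G : R * R -> R * R -> R) (hG : green_function G).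

Definition Tform (i j k l : nat) : R[i] :=
  intdA (fun p => Defs.D (fun w => mu i w * conjc (mu j w)) p *
    (mu k p * conjc (mu l p))).

(** The product inside [D] is bounded and smooth, being a polynomial on the disk, so the last clause
    of [green_function] replaces [D] by the kernel. *)
Lemma Tform_green i j k l : Tform i j k l =
  intdA (fun z => intdA (fun w => (G z w)%:C * (mu i w * conjc (mu j w))) *
    (mu k z * conjc (mu l z))).
Proof.
have bnd : bounded_on_disk (fun w => mu i w * conjc (mu j w)).
  have [M hM] := @bounded_mu_conj_mu R i j; exists M => p Dp.
  by rewrite normc_complexE lecR; exact: (hM p Dp).
apply: eq_intdA => z Dz; congr (_ * _); case: hG => _ _ _ _.
by apply => //; exact: smooth_mu_conj_mu.
Qed.

Lemma measurable_mu_conj_mu i j :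
  measurable_fun D (Re \o (fun w => mu i w * conjc (mu j w))) /\
  measurable_fun D (Im \o (fun w => mu i w * conjc (mu j w))).
Proof.
have [mR mI] := measurable_eval (@mu_conj_mu_exp R i j); split.
  apply: eq_measurable_fun (measurable_funTS mR) => w; rewrite inE => Dw /=.
  by rewrite mu_conj_mu.
apply: eq_measurable_fun (measurable_funTS mI) => w; rewrite inE => Dw /=.
by rewrite mu_conj_mu.
Qed.

(* [p] and [q] choose the indices attached to [w] and to [z], so that one
   statement covers both terms of the curvature formula. *)
Lemma green_mu_schur (c d : nat * nat -> R[i]) N s
    (p q : (nat * nat) * (nat * nat) -> nat * nat) : 0 < s ->
  (forall w z, disk w -> disk z ->
    normc (\sum_(x <- square_idx N) \sum_(y <- square_idx N)
      c x * d y * (mu (p (x, y)).1 w * conjc (mu (p (x, y)).2 w) *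
        (mu (q (x, y)).1 z * conjc (mu (q (x, y)).2 z)))) <=
    3 / (4 * pi) * (2^-1 * (s * kcol c N w + s^-1 * kcol d N z))) ->
  normc (\sum_(x <- square_idx N) \sum_(y <- square_idx N) c x * d y *
    Tform (p (x, y)).1 (p (x, y)).2 (q (x, y)).1 (q (x, y)).2) <=
  3 / (4 * pi) * (@area R / pi) * (2^-1 * (s * csq c N + s^-1 * csq d N)).
Proof.
move=> s0 dom.
pose L := [seq (x, y) | x <- square_idx N, y <- square_idx N].
have kap0 : 0 <= 3 / (4 * pi) :> R by rewrite divr_ge0// mulr_ge0// pi_ge0.
have [ic Ec] := kcol_integral c N; have [id Ed] := kcol_integral d N.
pose A : R := 3 / (4 * pi) * 2^-1 * s; pose B : R := 3 / (4 * pi) * 2^-1 * s^-1.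
have A0 : 0 <= A by rewrite mulr_ge0 ?(ltW s0)// mulr_ge0.
have B0 : 0 <= B by rewrite mulr_ge0 ?invr_ge0 ?(ltW s0)// mulr_ge0.
have iA : pm.-integrable D (EFin \o (fun w => A * kcol c N w * rho w)).
  by apply: eq_integrable (integrableZE mD A ic) => // w _; rewrite /= mulrA.
have iB : pm.-integrable D (EFin \o (fun w => B * kcol d N w * rho w)).
  by apply: eq_integrable (integrableZE mD B id) => // w _; rewrite /= mulrA.
have -> : \sum_(x <- square_idx N) \sum_(y <- square_idx N) c x * d y *
    Tform (p (x, y)).1 (p (x, y)).2 (q (x, y)).1 (q (x, y)).2 =
  \sum_(t <- L) c t.1 * d t.2 * intdA (fun z => intdA (fun w => (G z w)%:C *
    (mu (p t).1 w * conjc (mu (p t).2 w))) *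
      (mu (q t).1 z * conjc (mu (q t).2 z))).
  rewrite /L [in RHS]big_allpairs_dep; apply: eq_bigr => x _.
  apply: eq_bigr => y _.
  by rewrite Tform_green.
apply: le_trans (@green_schur _ _ hG _ L (fun t => c t.1 * d t.2)
  (fun t w => mu (p t).1 w * conjc (mu (p t).2 w))
  (fun t z => mu (q t).1 z * conjc (mu (q t).2 z))
  (fun w => A * kcol c N w) (fun z => B * kcol d N z)
  _ _ _ _ _ _ iA iB _) _.
- by move=> t; exact: (measurable_mu_conj_mu _ _).1.
- by move=> t; exact: (measurable_mu_conj_mu _ _).2.
- by move=> t; exact: bounded_mu_conj_mu.
- by move=> t; exact: cintegrable_mu_conj_mu_rho.
- by move=> w _; rewrite mulr_ge0 ?kcol_ge0.
- by move=> w _; rewrite mulr_ge0 ?kcol_ge0.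
- move=> z w Dz Dw; rewrite /L big_allpairs_dep.
  apply: le_trans (dom w z Dw Dz) _; rewrite /A /B.
  move: (3 / (4 * pi)) (kcol c N w) (kcol d N z) s^-1 => K x y t.
  by rewrite le_eqVlt; apply/orP; left; apply/eqP; ring.
rewrite le_eqVlt; apply/orP; left; apply/eqP.
transitivity (A * (\int[pm]_(w in D) (kcol c N w * rho w)) +
  B * (\int[pm]_(w in D) (kcol d N w * rho w))).
  rewrite -!RintegralZl//.
  by congr (_ + _); apply: eq_Rintegral => w _; rewrite mulrA.
rewrite Ec Ed /A /B.
by move: (3 / (4 * pi)) (_ / pi) (csq c N) (csq d N) s^-1 => K g x y t; ring.
Qed.

Definition Bform c d N : R[i] :=
  \sum_(x <- square_idx N) \sum_(y <- square_idx N) c x * d y *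
    (Tform x.1 x.2 y.1 y.2 + Tform x.1 y.2 y.1 x.2).

Lemma amgm_le (s a b u v : R) : 0 < s -> 0 <= a -> 0 <= b ->
  a ^+ 2 <= u -> b ^+ 2 <= v -> a * b <= 2^-1 * (s * u + s^-1 * v).
Proof.
move=> s0 a0 b0 au bv.
have si0 : 0 < s^-1 by rewrite invr_gt0.
have h1 := ler_wpM2l (ltW s0) au; have h2 := ler_wpM2l (ltW si0) bv.
have := mulr_ge0 (ltW si0) (sqr_ge0 (s * a - b)).
have -> : s^-1 * (s * a - b) ^+ 2 = s * a ^+ 2 + s^-1 * b ^+ 2 - 2 * (a * b).
  by field; rewrite gt_eqF.
lra.
Qed.

Lemma Bform_amgm c d N s : 0 < s -> normc (Bform c d N) <=
  3 / (4 * pi) * (@area R / pi) * (s * csq c N + s^-1 * csq d N).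
Proof.
move=> s0.
have dom (w z w' z' : R * R) : disk z -> disk z' ->
    normc (kform c N w z * kform d N w' z') <=
    3 / (4 * pi) * (2^-1 * (s * kcol c N w + s^-1 * kcol d N w')).
  move=> Dz Dz'; rewrite Normc.normcM.
  apply: le_trans (amgm_le s0 (normc_ge0 _) (normc_ge0 _)
    (kform_le c N w Dz) (kform_le d N w' Dz')) _.
  move: (3 / (4 * pi)) (kcol c N w) (kcol d N w') s^-1 => K x y t.
  by rewrite le_eqVlt; apply/orP; left; apply/eqP; ring.
have h1 := @green_mu_schur c d N s (fun t => t.1) (fun t => t.2) s0.
(* Second curvature term: with x = (i,j) and y = (k,l), the indices i, l go with w and k, j with z.
   Regrouped, the summand belongs to F(w,z) E(z,w). *)
have h2 := @green_mu_schur c d N s (fun t => (t.1.1, t.2.2))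
  (fun t => (t.2.1, t.1.2)) s0.
have -> : Bform c d N =
    \sum_(x <- square_idx N) \sum_(y <- square_idx N) c x * d y *
      Tform x.1 x.2 y.1 y.2 +
    \sum_(x <- square_idx N) \sum_(y <- square_idx N) c x * d y *
      Tform x.1 y.2 y.1 x.2.
  rewrite -big_split; apply: eq_bigr => x _ /=; rewrite -big_split.
  by apply: eq_bigr => y _ /=; rewrite mulrDr.
apply: le_trans (le_normcD _ _) _.
apply: le_trans (lerD (h1 _) (h2 _)) _ => [w z Dw Dz|w z Dw Dz|].
- apply: le_trans (dom w w z z Dw Dz); rewrite /kform big_distrlr/=.
  rewrite le_eqVlt; apply/orP; left; apply/eqP; congr normc.
  by apply: eq_bigr => x _; apply: eq_bigr => y _; rewrite mulrACA.
- apply: le_trans (dom w z z w Dz Dw); rewrite /kform big_distrlr/=.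
  rewrite le_eqVlt; apply/orP; left; apply/eqP; congr normc.
  apply: eq_bigr => x _; apply: eq_bigr => y _.
  rewrite [RHS]mulrACA; congr (_ * _); rewrite -!mulrA; congr (_ * _).
  by rewrite [LHS]mulrC [LHS]mulrAC [LHS]mulrC.
move: (3 / (4 * pi)) (_ / pi) (csq c N) (csq d N) s^-1 => K g x y t.
by rewrite le_eqVlt; apply/orP; left; apply/eqP; field.
Qed.

(** With p, q the square roots of P, Q, the optimal weight q/p may be undefined or zero. The weight
    (q+t)/(p+t) is used instead, and t tends to 0. *)
Lemma le_sqrt_of_amgm (x P Q : R) : 0 <= P -> 0 <= Q ->
  (forall s, 0 < s -> x <= s * P + s^-1 * Q) -> x <= 2 * (Num.sqrt P * Num.sqrt Q).
Proof.
move=> P0 Q0; rewrite -{1}(sqr_sqrtr P0) -{1}(sqr_sqrtr Q0).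
move: (sqrtr_ge0 P) (sqrtr_ge0 Q); move: (Num.sqrt P) (Num.sqrt Q) => p q p0 q0 h.
have {}h t : 0 < t -> x <= 2 * ((p + t) * (q + t)).
  move=> t0; have pt : 0 < p + t by lra.
  have qt : 0 < q + t by lra.
  apply: le_trans (h ((q + t) / (p + t)) (divr_gt0 qt pt)) _.
  rewrite invf_div mulr_natl mulr2n lerD//.
    have e : p ^+ 2 <= (p + t) ^+ 2 by nra.
    rewrite mulrAC ler_pdivrMr//; have := ler_wpM2l (ltW qt) e; lra.
  have e : q ^+ 2 <= (q + t) ^+ 2 by nra.
  rewrite mulrAC ler_pdivrMr//; have := ler_wpM2l (ltW pt) e; lra.
rewrite leNgt; apply/negP => lt.
(* If the excess [e] were positive, t = e/u would be below 1, and 2t(p+q) + 2t^2 < tu = e would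
   contradict the perturbed bound. *)
pose e := x - 2 * (p * q); pose u := e + 2 * (p + q) + 2.
have e0 : 0 < e by rewrite /e; lra.
have u0 : 0 < u by rewrite /u; lra.
have t0 : 0 < e / u by exact: divr_gt0.
have tu : e / u * u = e by rewrite divfK// gt_eqF.
have := h _ t0; move: tu t0; move: (e / u) => t tu t0.
by rewrite /u in tu; rewrite /e in e0 tu; nra.
Qed.

Lemma Bform_le c d N : normc (Bform c d N) <=
  3 / (4 * pi) * (@area R / pi) *
    (2 * (Num.sqrt (csq c N) * Num.sqrt (csq d N))).
Proof.
have area0 : 0 < @area R := lt_le_trans ltr01 area_ge1.
have k0 : 0 < 3 / (4 * pi) * (@area R / pi) :> R.
  by rewrite !(divr_gt0, mulr_gt0)// pi_gt0.
rewrite -ler_pdivrMl//; apply: le_sqrt_of_amgm; rewrite ?csq_ge0// => s s0.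
by rewrite ler_pdivrMl//; exact: Bform_amgm.
Qed.

End curvature_form.

(** * Reduction of the curvature operator to its (1,1) part *)

Section real_basis.
Context {R : realType}.
Local Notation mu := (@mu R).
Local Notation iC := (0 +i* 1 : R[i]).

(** A common shape for [vt], [vtbar], [vx] and [vy], so that tangency and expansion by linearity are
    proved once. *)
Definition cv (a b : R[i]) (i : nat) : cvect R := a *: vt R i + b *: vtbar R i.

Lemma tangent_cv a b i : tangent (cv a b i).
Proof.
split.
  rewrite (_ : (cv a b i).1 = (fun p => a * mu i p)); first exact: H11_scale_mu.
  by apply/funext => p; rewrite /cv /= fctE scaler0 addr0.
rewrite (_ : (fun p => _) = (fun p => conjc b * mu i p)); first exact: H11_scale_mu.
apply/funext => p; rewrite /cv /= fctE scaler0 add0r.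
by rewrite -[LHS]/(conjc (b * conjc (mu i p))) conjcM conjcK.
Qed.

Lemma vtE i : vt R i = cv 1 0 i.
Proof. by rewrite /cv scale1r scale0r addr0. Qed.

Lemma vtbarE i : vtbar R i = cv 0 1 i.
Proof. by rewrite /cv scale1r scale0r add0r. Qed.

Lemma vxE i : vx R i = cv 1 1 i.
Proof. by rewrite /cv !scale1r. Qed.

Lemma vyE i : vy R i = cv iC (- iC) i.
Proof. by rewrite /cv /vy scalerBr scaleNr. Qed.

Lemma tangent_vt i : tangent (vt R i). Proof. by rewrite vtE; exact: tangent_cv. Qed.
Lemma tangent_vtbar i : tangent (vtbar R i).
Proof. by rewrite vtbarE; exact: tangent_cv. Qed.

Lemma lin_on_tangent_cv (h : cvect R -> R[i]^o) a b i : lin_on_tangent h ->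
  h (cv a b i) = a * h (vt R i) + b * h (vtbar R i).
Proof.
move=> lh.
have t0 : tangent (0 : cvect R).
  by have := tangent_cv 0 0 0; rewrite /cv !scale0r addr0.
have h0 : h 0 = 0.
  have := lh 1 0 0 t0 t0; rewrite scaler0 addr0 mul1r => /eqP.
  by rewrite -subr_eq0 opprD addNKr oppr_eq0 => /eqP.
have tb : tangent (b *: vtbar R i).
  by have := tangent_cv 0 b i; rewrite /cv scale0r add0r.
rewrite /cv lh//; last exact: tangent_vt.
by rewrite -[b *: _]addr0 lh ?h0 ?addr0//; exact: tangent_vtbar.
Qed.

(* [(false, i)] labels [d/dx_i] and [(true, i)] labels [d/dy_i]. *)
Definition basis_vec (u : bool * nat) : cvect R :=
  cv (if u.1 then iC else 1) (if u.1 then - iC else 1) u.2.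

Definition tri_idx N := [seq p <- square_idx N | (p.1 < p.2)%N].

Definition labels N : seq ((bool * nat) * (bool * nat)) :=
  [seq ((false, p.1), (false, p.2)) | p <- tri_idx N] ++
  [seq ((false, p.1), (true, p.2)) | p <- square_idx N] ++
  [seq ((true, p.1), (true, p.2)) | p <- tri_idx N].

Definition coef (V : bivector R) (u : (bool * nat) * (bool * nat)) : R :=
  (if u.1.1 then cyy V else if u.2.1 then cxy V else cxx V) u.1.2 u.2.2.

Lemma truncationE (V : bivector R) N : truncation V N =
  [seq (coef V u, (basis_vec u.1, basis_vec u.2)) | u <- labels N].
Proof.
rewrite /truncation /labels !map_cat -!map_comp.
by congr (_ ++ _ ++ _); apply: eq_map => p /=; rewrite ?vxE ?vyE.
Qed.

Lemma sum_square_idxC (U : nmodType) (f : nat * nat -> U) N :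
  \sum_(x <- square_idx N) f x = \sum_(x <- square_idx N) f (x.2, x.1).
Proof. by rewrite !sum_square_idx exchange_big. Qed.

Lemma sum_labels (U : nmodType) (f : (bool * nat) * (bool * nat) -> U) N :
  \sum_(u <- labels N) f u =
  \sum_(x <- square_idx N | (x.1 < x.2)%N) f ((false, x.1), (false, x.2)) +
  (\sum_(x <- square_idx N) f ((false, x.1), (true, x.2)) +
  \sum_(x <- square_idx N | (x.1 < x.2)%N) f ((true, x.1), (true, x.2))).
Proof. by rewrite /labels !big_cat !big_map !big_filter. Qed.

(** The two families are added because x_i /\ x_j and y_i /\ y_j have the same (1,1) part, t_i /\
    tbar_j - t_j /\ tbar_i. *)
Definition skew_coef (V : bivector R) (x : nat * nat) : R :=
  if (x.1 < x.2)%N then cxx V x.1 x.2 + cyy V x.1 x.2 else 0.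

(* The coefficients of the (1,1) part of the bivector, the only part on which
   the curvature tensor does not vanish. *)
Definition coef11 (V : bivector R) (x : nat * nat) : R[i] :=
  (skew_coef V x - skew_coef V (x.2, x.1)) +i*
  (- (cxy V x.1 x.2 + cxy V x.2 x.1)).

(** [h] stands for the curvature tensor as a function of its first or of its last pair of arguments.
    Only mixed terms survive, and antisymmetry puts the (1,0) vector first. *)
Lemma basis_vec_bivector (h : cvect R -> cvect R -> R[i]^o) u v :
  (forall Y, tangent Y -> lin_on_tangent (fun X => h X Y)) ->
  (forall X, tangent X -> lin_on_tangent (fun Y => h X Y)) ->
  (forall X Y, tangent X -> tangent Y -> h X Y = - h Y X) ->
  (forall X Y, tangent X -> tangent Y ->
    (type10 X /\ type10 Y) \/ (type01 X /\ type01 Y) -> h X Y = 0) ->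
  h (basis_vec u) (basis_vec v) =
    (if u.1 then iC else 1) * (if v.1 then - iC else 1) *
      h (vt R u.2) (vtbar R v.2) -
    (if u.1 then - iC else 1) * (if v.1 then iC else 1) *
      h (vt R v.2) (vtbar R u.2).
Proof.
move=> l1 l2 anti type.
have tt i := tangent_vt i; have tb i := tangent_vtbar i.
rewrite /basis_vec (lin_on_tangent_cv _ _ _ (l1 _ (tangent_cv _ _ _))).
rewrite !(lin_on_tangent_cv _ _ _ (l2 _ _))//.
rewrite [h (vt R u.2) (vt R v.2)]type//; last by left.
rewrite [h (vtbar R u.2) (vtbar R v.2)]type//; last by right.
rewrite [h (vtbar R u.2) (vt R v.2)]anti//.
by ring.
Qed.

Lemma sum_labels_coef11 (V : bivector R) (h : cvect R -> cvect R -> R[i]^o) N :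
  (forall Y, tangent Y -> lin_on_tangent (fun X => h X Y)) ->
  (forall X, tangent X -> lin_on_tangent (fun Y => h X Y)) ->
  (forall X Y, tangent X -> tangent Y -> h X Y = - h Y X) ->
  (forall X Y, tangent X -> tangent Y ->
    (type10 X /\ type10 Y) \/ (type01 X /\ type01 Y) -> h X Y = 0) ->
  \sum_(u <- labels N) (coef V u)%:C * h (basis_vec u.1) (basis_vec u.2) =
  \sum_(x <- square_idx N) coef11 V x * h (vt R x.1) (vtbar R x.2).
Proof.
move=> l1 l2 anti type; pose r x := h (vt R x.1) (vtbar R x.2).
under eq_bigr do rewrite (basis_vec_bivector _ _ l1 l2 anti type).
rewrite sum_labels /=.
transitivity (\sum_(x <- square_idx N) ((skew_coef V x)%:C * r x +
    - (skew_coef V x)%:C * r (x.2, x.1) +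
    (- iC * (cxy V x.1 x.2)%:C * r x +
     - iC * (cxy V x.1 x.2)%:C * r (x.2, x.1)))).
  rewrite addrCA [X in _ + X]addrC addrC -big_split /= big_mkcond -big_split /=.
  apply: eq_bigr => -[i j] _; rewrite /skew_coef /coef /r /=.
  have ii : iC * iC = -1 by rewrite -expr2 sqr_i.
  have e1 : iC * - iC = 1 by rewrite mulrN ii opprK.
  have e2 : - iC * iC = 1 by rewrite mulNr ii opprK.
  case: ifP => ij; last by rewrite rmorph0; ring.
  by rewrite rmorphD e1 e2; ring.
rewrite !big_split /=.
(* Exchanging the indices in the transposed terms collects both contributions to each [r x]. *)
rewrite [X in _ + X + _]sum_square_idxC [X in _ + (_ + X)]sum_square_idxC /=.
rewrite -!big_split /=; apply: eq_bigr => -[i j] _.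
rewrite /r /= -!mulrDl; congr (_ * _); apply/eqP; rewrite eq_complex /coef11 /=.
by apply/andP; split; apply/eqP; ring.
Qed.

Lemma Qtilde_truncE (Rm : tensor4 R) (hRm : wp_curvature_tensor Rm)
    (V W : bivector R) N :
  Qtilde_trunc Rm V W N = Bform (coef11 V) (coef11 W) N.
Proof.
have tt i := tangent_vt i; have tb i := tangent_vtbar i.
have tv u : tangent (basis_vec u) := tangent_cv _ _ _.
rewrite /Qtilde_trunc !truncationE big_map.
transitivity (\sum_(v <- labels N) (coef W v)%:C *
    \sum_(u <- labels N) (coef V u)%:C *
      Rm (basis_vec u.1) (basis_vec u.2) (basis_vec v.1) (basis_vec v.2)).
  under eq_bigr do rewrite big_map /=.
  rewrite exchange_big /=; apply: eq_bigr => v _; rewrite mulr_sumr.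
  by apply: eq_bigr => u _; rewrite rmorphM; ring.
transitivity (\sum_(v <- labels N) (coef W v)%:C *
    \sum_(x <- square_idx N) coef11 V x *
      Rm (vt R x.1) (vtbar R x.2) (basis_vec v.1) (basis_vec v.2)).
  apply: eq_bigr => v _; congr (_ * _).
  apply: (@sum_labels_coef11 V (fun X Y => Rm X Y _ _)).
  - by move=> Y tY; exact: wp_lin1.
  - by move=> X tX; exact: wp_lin2.
  - by move=> X Y tX tY; exact: wp_anti12.
  - by move=> X Y tX tY; exact: wp_type12.
transitivity (\sum_(x <- square_idx N) coef11 V x *
    \sum_(v <- labels N) (coef W v)%:C *
      Rm (vt R x.1) (vtbar R x.2) (basis_vec v.1) (basis_vec v.2)).
  under eq_bigr do rewrite mulr_sumr.
  rewrite exchange_big /=; apply: eq_bigr => x _; rewrite mulr_sumr.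
  by apply: eq_bigr => v _; rewrite mulrCA.
rewrite /Bform !big_seq; apply: eq_bigr => x xN.
rewrite (@sum_labels_coef11 W (fun X Y => Rm _ _ X Y)).
- rewrite mulr_sumr big_seq [RHS]big_seq; apply: eq_bigr => y yN.
  rewrite -mulrA; congr (_ * (_ * _)).
  case: x xN => i j /allpairsP[[i' j'] [/= i0 j0 [-> ->]]].
  case: y yN => k l /allpairsP[[k' l'] [/= k0 l0 [-> ->]]].
  move: i0 j0 k0 l0; rewrite !mem_iota.
  move=> /andP[i0 _] /andP[j0 _] /andP[k0 _] /andP[l0 _].
  exact: (wp_formula hRm).
- by move=> Y tY; exact: wp_lin3.
- by move=> X tX; exact: wp_lin4.
- by move=> X Y tX tY; exact: wp_anti34.
- by move=> X Y tX tY; exact: wp_type34.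
Qed.

End real_basis.

(** * Comparison of the (1,1) coefficients with the Euclidean norm *)

Section norms.
Context {R : realType}.
Local Notation mu := (@mu R).
Local Notation iC := (0 +i* 1 : R[i]).
Implicit Types V W : bivector R.

Definition nsq V N : R := \sum_(u <- labels N) coef V u ^+ 2.

(** In the real part the two skew terms are never both nonzero, so the square splits exactly; one
    factor 2 comes from transposition and one from adding [cxx] and [cyy]. In the imaginary part
    they come from transposition and from (b + b')^2 <= 2b^2 + 2b'^2. *)
Lemma csq_coef11_le V N : csq (coef11 V) N <= 4 * nsq V N.
Proof.
pose A x := skew_coef V x; pose b x := cxy V x.1 x.2.
have -> : csq (coef11 V) N = \sum_(x <- square_idx N)
    ((A x - A (x.2, x.1)) ^+ 2 + (b x + b (x.2, x.1)) ^+ 2).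
  by apply: eq_bigr => x _; rewrite sqr_normcE /coef11 /= sqrrN.
apply: (@le_trans _ _ (\sum_(x <- square_idx N) (A x ^+ 2 + A (x.2, x.1) ^+ 2 +
    (2 * b x ^+ 2 + 2 * b (x.2, x.1) ^+ 2)))).
  apply: ler_sum => -[i j] _ /=; apply: lerD.
    rewrite /A /skew_coef /=; case: ltnP => // ij; case: ltnP => // ji.
    - by have := leq_trans ij (ltnW ji); rewrite ltnn.
    - by rewrite subr0 expr0n addr0.
    - by rewrite sub0r sqrrN expr0n add0r.
    - by rewrite subr0 expr0n addr0.
  by have := sqr_ge0 (b (i, j) - b (j, i)); rewrite /=; nra.
rewrite !big_split /=.
rewrite -(sum_square_idxC (fun x => A x ^+ 2)).
rewrite -(sum_square_idxC (fun x => 2 * b x ^+ 2)).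
rewrite /nsq sum_labels /coef /=.
set S2 := \sum_(x <- square_idx N) cxy V x.1 x.2 ^+ 2.
have -> : \sum_(x <- square_idx N) 2 * b x ^+ 2 = 2 * S2 by rewrite mulr_sumr.
have h : \sum_(x <- square_idx N) A x ^+ 2 <=
    2 * (\sum_(x <- square_idx N | (x.1 < x.2)%N) cxx V x.1 x.2 ^+ 2) +
    2 * (\sum_(x <- square_idx N | (x.1 < x.2)%N) cyy V x.1 x.2 ^+ 2).
  rewrite -mulrDr -big_split /= mulr_sumr [leRHS]big_mkcond.
  apply: ler_sum => x _; rewrite /A /skew_coef; case: ifP => _.
    by have := sqr_ge0 (cxx V x.1 x.2 - cyy V x.1 x.2); nra.
  by rewrite expr0n.
by move: h; lra.
Qed.

Lemma metric_basis_vec (u v : bool * nat) : (0 < u.2)%N -> (0 < v.2)%N ->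
  metric (basis_vec u) (basis_vec v) = if u == v then @area R / pi else 0.
Proof.
move=> u0 v0; set a : R[i] := if u.1 then iC else 1.
set b : R[i] := if v.1 then iC else 1.
have fstE w : (basis_vec w).1 = (fun p => (if w.1 then iC else 1) * mu w.2 p).
  by apply/funext => p; rewrite /basis_vec /cv /= fctE scaler0 addr0.
rewrite /metric /inner11 intdAE !fstE.
have -> : cintegral (@plane_measure R) (@disk R) (fun p => a * mu u.2 p *
      Num.conj (b * mu v.2 p) * (rho p)%:C) =
    a * conjc b * (if u.2 == v.2 then @area R / pi else 0)%:C.
  rewrite -gram// -cintegralZ//; last 2 first.
  - exact: measurable_disk.
  - exact: cintegrable_mu_conj_mu_rho.
  apply: eq_cintegral => p _; rewrite conjE conjcM.
  by rewrite mulrACA [RHS]mulrA.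
rewrite ReMr /a /b; case: u v {a b u0 v0} => [[] i] [[] j];
  rewrite xpair_eqE /=; case: eqVneq => _ //=; ring.
Qed.

Lemma uniq_square_idx N : uniq (square_idx N).
Proof. by apply: allpairs_uniq; rewrite ?iota_uniq// => -[? ?] [? ?]. Qed.

Lemma mem_square_idx N x :
  (x \in square_idx N) = (0 < x.1 <= N)%N && (0 < x.2 <= N)%N.
Proof.
apply/allpairsP/idP => [[[i j] [/= + + ->]]|/andP[h1 h2]].
  by rewrite !mem_iota /= !add1n !ltnS => -> ->.
by exists x; split; rewrite ?mem_iota ?add1n ?ltnS//; case: x {h1 h2}.
Qed.

Lemma uniq_labels N : uniq (labels N).
Proof.
have ut : uniq (tri_idx N) by rewrite filter_uniq ?uniq_square_idx.
have inj (a b : bool) :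
    injective (fun p : nat * nat => ((a, p.1), (b, p.2))).
  by move=> [? ?] [? ?] [-> ->].
rewrite cat_uniq map_inj_uniq ?ut//=; apply/andP; split.
  apply/hasPn => u; rewrite mem_cat => /orP[] /mapP[x _ ->];
    by apply/mapP => -[y _].
rewrite cat_uniq !map_inj_uniq ?ut ?uniq_square_idx//= andbT.
by apply/hasPn => u /mapP[x _ ->]; apply/mapP => -[y _].
Qed.

(* The two vectors of a label are listed in lexicographic order, so that no
   label is another one reversed. *)
Lemma labels_spec N u : u \in labels N -> [/\ (0 < u.1.2)%N, (0 < u.2.2)%N &
  forall v, v \in labels N -> ~~ ((u.1 == v.2) && (u.2 == v.1))].
Proof.
have tri x : x \in tri_idx N -> [/\ (0 < x.1)%N, (0 < x.2)%N & (x.1 < x.2)%N].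
  by rewrite mem_filter mem_square_idx => /and3P[-> /andP[-> _] /andP[-> _]].
have sq x : x \in square_idx N -> (0 < x.1)%N /\ (0 < x.2)%N.
  by rewrite mem_square_idx => /andP[/andP[-> _] /andP[-> _]].
rewrite !mem_cat => /or3P[] /mapP[x xN ->] /=;
  [have [x1 x2 x12] := tri x xN|have [x1 x2] := sq x xN|
   have [x1 x2 x12] := tri x xN]; split => // v;
  rewrite !mem_cat => /or3P[] /mapP[y yN ->];
  apply/negP => /andP[/eqP /= e1 /eqP /= e2];
  (try by case: e1); (try by case: e2);
  case: e1 e2 x12 => -> [->]; have [_ _ y12] := tri y yN;
  by rewrite ltnNge ltnW.
Qed.

(** The basis bivectors are orthogonal: the crossed product of metrics vanishes by [labels_spec],
    and the direct one is nonzero only on the diagonal, where each metric gives area/pi. *)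
Lemma eu_truncE V N : eu_trunc V V N = (@area R / pi) ^+ 2 * nsq V N.
Proof.
rewrite /eu_trunc !truncationE big_map /nsq mulr_sumr !big_seq.
apply: eq_bigr => u uN; rewrite big_map /=.
have [u1 u2 uP] := labels_spec uN.
transitivity (\sum_(v <- labels N) if v == u then
    (@area R / pi) ^+ 2 * coef V u ^+ 2 else 0).
  rewrite !big_seq; apply: eq_bigr => v vN; have [v1 v2 _] := labels_spec vN.
  rewrite !metric_basis_vec//.
  have -> : (if u.1 == v.2 then @area R / pi else 0) *
      (if u.2 == v.1 then @area R / pi else 0) = 0 :> R.
    by have := uP v vN; case: ifP => //=; case: ifP => //=; rewrite ?mulr0 ?mul0r.
  have -> : (v == u) = (u.1 == v.1) && (u.2 == v.2).
    by case: u v {uN u1 u2 uP vN v1 v2} => [? ?] [? ?]; rewrite eq_sym.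
  rewrite subr0; case: eqVneq => [e1|_] /=; last by rewrite mul0r mulr0.
  case: eqVneq => [e2|_] /=; last by rewrite !mulr0.
  have -> : v = u by case: u v e1 e2 {uN u1 u2 uP vN v1 v2} => [? ?] [? ?] /= -> ->.
  by rewrite -!expr2 mulrC.
rewrite (bigD1_seq u) ?uniq_labels//= eqxx big1 ?addr0// => v vu.
by rewrite (negPf vu).
Qed.

End norms.

(** * Convergence and bounds *)

Lemma normc_ge_ReB {R : realType} (x y : R[i]) : `|Re x - Re y| <= normc (x - y).
Proof. by have := normc_ge_Re (x - y); case: x y => [a b] []. Qed.

Lemma normc_ge_ImB {R : realType} (x y : R[i]) : `|Im x - Im y| <= normc (x - y).
Proof. by have := normc_ge_Im (x - y); case: x y => [a b] []. Qed.

Section convergence.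
Context {R : realType}.
Implicit Types (V W : bivector R) (c d : nat * nat -> R[i]).

Lemma sum_le_esum (T : choiceType) (S : set T) (f : T -> R) (s : seq T) :
  uniq s -> (forall x, x \in s -> S x) -> (forall x, 0 <= f x) ->
  ((\sum_(x <- s) f x)%:E <= \esum_(x in S) (f x)%:E)%E.
Proof.
move=> us sS f0; apply: esum_ge; exists [set` s].
  by split; [exact: finite_seq|move=> x /= /sS].
by rewrite -fsbig_seq// sumEFin.
Qed.

Lemma nsq_bounded V : square_summable V -> exists C, forall N, nsq V N <= C.
Proof.
have fineE (x : \bar R) (y : R) : (0 <= x -> x < +oo -> y%:E <= x -> (y <= fine x)%R)%E.
  by case: x => [x| |]//; rewrite ?lee_fin.
move=> [sxx sxy syy].
have e0 (S : set (nat * nat)) (f : nat * nat -> R) :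
    (0 <= \esum_(x in S) (f x ^+ 2)%:E)%E.
  by apply: esum_ge0 => x _; rewrite lee_fin sqr_ge0.
eexists => N; rewrite /nsq sum_labels /coef /=; apply: lerD; last apply: lerD.
- apply: fineE (e0 _ _) sxx _; rewrite -big_filter.
  apply: sum_le_esum => [|[i j]|x]; last exact: sqr_ge0.
    by rewrite filter_uniq// uniq_square_idx.
  by rewrite mem_filter mem_square_idx /= => /and3P[-> /andP[-> _] _].
- apply: fineE (e0 _ _) sxy _.
  apply: sum_le_esum => [|[i j]|x]; last exact: sqr_ge0.
    exact: uniq_square_idx.
  by rewrite mem_square_idx /= => /andP[/andP[-> _] /andP[-> _]].
- apply: fineE (e0 _ _) syy _; rewrite -big_filter.
  apply: sum_le_esum => [|[i j]|x]; last exact: sqr_ge0.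
    by rewrite filter_uniq// uniq_square_idx.
  by rewrite mem_filter mem_square_idx /= => /and3P[-> /andP[-> _] _].
Qed.

Definition in_square M (x : nat * nat) := (x.1 <= M)%N && (x.2 <= M)%N.

Lemma sum_in_square (U : nmodType) (f : nat * nat -> U) M N : (M <= N)%N ->
  \sum_(x <- square_idx N | in_square M x) f x = \sum_(x <- square_idx M) f x.
Proof.
move=> MN; rewrite -big_filter; apply: perm_big; apply: uniq_perm.
- by rewrite filter_uniq// uniq_square_idx.
- exact: uniq_square_idx.
move=> [i j]; rewrite mem_filter !mem_square_idx /in_square /=.
apply/idP/idP => [/and3P[/andP[-> ->] /andP[-> _] /andP[-> _]]//|].
move=> /andP[/andP[-> iM] /andP[-> jM]]; rewrite iM jM /=.
by rewrite (leq_trans iM MN) (leq_trans jM MN).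
Qed.

Lemma sum_square_mono (P : pred (nat * nat)) (f : nat * nat -> R) M N :
  (forall x, 0 <= f x) -> (M <= N)%N ->
  \sum_(x <- square_idx M | P x) f x <= \sum_(x <- square_idx N | P x) f x.
Proof.
move=> f0 MN; rewrite big_mkcond [leRHS]big_mkcond -(sum_in_square _ MN).
rewrite [leLHS]big_mkcond; apply: ler_sum => x _.
by case: (P x); case: ifP.
Qed.

Lemma csq_mono c : {homo csq c : M N / (M <= N)%N >-> M <= N}.
Proof. by move=> M N; apply: sum_square_mono => x; exact: sqr_ge0. Qed.

Lemma nsq_mono V : {homo nsq V : M N / (M <= N)%N >-> M <= N}.
Proof.
move=> M N MN; rewrite /nsq !sum_labels.
by apply: lerD; last apply: lerD; apply: sum_square_mono => // x;
  exact: sqr_ge0.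
Qed.

Definition cutoff M c (x : nat * nat) : R[i] := if in_square M x then c x else 0.

Lemma csq_cutoff M N c : (M <= N)%N -> csq (cutoff M c) N = csq c M.
Proof.
move=> MN; rewrite /csq -(sum_in_square _ MN) [RHS]big_mkcond.
apply: eq_bigr => x _; rewrite /cutoff; case: ifP => // _.
by rewrite Normc.normc0 expr0n.
Qed.

Lemma csq_tail M N c : (M <= N)%N ->
  csq (fun x => c x - cutoff M c x) N = csq c N - csq c M.
Proof.
move=> MN; rewrite -[X in _ - X](csq_cutoff c MN) /csq -sumrB.
apply: eq_bigr => x _; rewrite /cutoff; case: ifP => _.
  by rewrite !subrr Normc.normc0 expr0n.
by rewrite subr0 Normc.normc0 expr0n subr0.
Qed.

Lemma Bform_cutoff M N c d : (M <= N)%N ->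
  Bform (cutoff M c) (cutoff M d) N = Bform c d M.
Proof.
move=> MN; rewrite /Bform -(sum_in_square _ MN) [RHS]big_mkcond.
apply: eq_bigr => x _; rewrite /cutoff; case: ifP => _; last first.
  by rewrite big1// => y _; rewrite !mul0r.
rewrite -(sum_in_square _ MN) [RHS]big_mkcond; apply: eq_bigr => y _.
by case: ifP => _; rewrite ?mulr0 ?mul0r.
Qed.

Lemma BformBl c c' d N :
  Bform (fun x => c x - c' x) d N = Bform c d N - Bform c' d N.
Proof.
rewrite /Bform -sumrB; apply: eq_bigr => x _; rewrite -sumrB.
by apply: eq_bigr => y _; rewrite !mulrBl.
Qed.

Lemma BformBr c d d' N :
  Bform c (fun x => d x - d' x) N = Bform c d N - Bform c d' N.
Proof.
rewrite /Bform -sumrB; apply: eq_bigr => x _; rewrite -sumrB.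
by apply: eq_bigr => y _; rewrite mulrBr !mulrBl.
Qed.

(** The truncation at [M] is the truncation at [N] of the cut-off families. The difference then
    telescopes, each term having a tail in one argument. *)
Lemma Bform_tail M N c d : (M <= N)%N -> Bform c d N - Bform c d M =
  Bform (fun x => c x - cutoff M c x) d N +
  Bform (cutoff M c) (fun x => d x - cutoff M d x) N.
Proof.
by move=> MN; rewrite BformBl BformBr (Bform_cutoff _ _ MN) subrKA.
Qed.

Lemma cauchy_seq_cvg (u : nat -> R) :
  (forall e, 0 < e -> exists M, forall N, (M <= N)%N -> `|u M - u N| < e) ->
  cvgn u.
Proof.
move=> h; apply: cauchy_cvg; apply: cauchy_exP => e e0.
by have [M hM] := h e e0; exists (u M); exists M.
Qed.

Lemma bounded_mono_tail (u : nat -> R) C :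
  {homo u : M N / (M <= N)%N >-> M <= N} -> (forall N, u N <= C) ->
  forall e, 0 < e -> exists M, forall N, (M <= N)%N -> u N - u M <= e.
Proof.
move=> um uC e e0.
have cu : cvgn u.
  by apply: nondecreasing_is_cvgn => //; exists C => _ [N _ <-].
have /cvgrPdist_le/(_ e e0)[M _ hM] := cu.
exists M => N MN; have := nondecreasing_cvgn_le um cu N.
have /= := hM M (leqnn M); have := ler_norm (limn u - u M); lra.
Qed.

Variables (G : R * R -> R * R -> R) (hG : green_function G).

Lemma Bform_cauchy c d C E : (forall N, csq c N <= C) ->
  (forall N, csq d N <= E) -> forall e, 0 < e -> exists M, forall N,
  (M <= N)%N -> normc (Bform c d M - Bform c d N) < e.
Proof.
move=> cC dE e e0.
have /= hB := fun c d N => Bform_le hG c d N.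
move: (3 / (4 * pi) * (area / pi)) hB => K hB.
(* With tails of norm at most t, the two terms add up to at most t (K' - 1); the summand 1 keeps K'
   positive and the final inequality strict. *)
pose K' := 2 * `|K| * (Num.sqrt E + Num.sqrt C) + 1.
have K'0 : 0 < K'.
  by rewrite ltr_wpDl// mulr_ge0 ?addr_ge0 ?sqrtr_ge0// mulr_ge0.
pose t := e / K'; have t0 : 0 < t by exact: divr_gt0.
have [M1 h1] := bounded_mono_tail (@csq_mono c) cC (exprn_gt0 2 t0).
have [M2 h2] := bounded_mono_tail (@csq_mono d) dE (exprn_gt0 2 t0).
have tail (x : nat * nat -> R[i]) M0 M N :
    (forall N, (M0 <= N)%N -> csq x N - csq x M0 <= t ^+ 2) ->
    (M0 <= M)%N -> (M <= N)%N ->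
    Num.sqrt (csq (fun y => x y - cutoff M x y) N) <= t.
  move=> h M0M MN; rewrite csq_tail// -[leRHS]ger0_norm ?(ltW t0)// -sqrtr_sqr.
  rewrite ler_sqrt ?sqr_ge0//; apply: le_trans (h N (leq_trans M0M MN)).
  by rewrite lerB// csq_mono.
pose M := maxn M1 M2; exists M => N MN.
rewrite -normcN opprB (Bform_tail _ _ MN); apply: le_lt_trans (le_normcD _ _) _.
have sE : Num.sqrt (csq d N) <= Num.sqrt E.
  by rewrite ler_sqrt// (le_trans (csq_ge0 d N) (dE N)).
have sC : Num.sqrt (csq (cutoff M c) N) <= Num.sqrt C.
  by rewrite csq_cutoff// ler_sqrt// (le_trans (csq_ge0 c N) (cC N)).
have b1 : normc (Bform (fun x => c x - cutoff M c x) d N) <=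
    `|K| * (2 * (t * Num.sqrt E)).
  apply: le_trans (hB _ _ _) _; apply: le_trans (ler_norm _) _; rewrite normrM.
  rewrite ler_wpM2l// ger0_norm ?mulr_ge0 ?sqrtr_ge0// ler_wpM2l//.
  by rewrite ler_pM ?sqrtr_ge0// (tail c M1)// leq_maxl.
have b2 : normc (Bform (cutoff M c) (fun x => d x - cutoff M d x) N) <=
    `|K| * (2 * (Num.sqrt C * t)).
  apply: le_trans (hB _ _ _) _; apply: le_trans (ler_norm _) _; rewrite normrM.
  rewrite ler_wpM2l// ger0_norm ?mulr_ge0 ?sqrtr_ge0// ler_wpM2l//.
  by rewrite ler_pM ?sqrtr_ge0// (tail d M2)// leq_maxr.
apply: le_lt_trans (lerD b1 b2) _.
have -> : e = t * K' by rewrite /t divfK// gt_eqF.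
by rewrite /K'; lra.
Qed.

Lemma normc_lim_le (u : nat -> R[i]^o) (l : R[i]) (C : R) :
  u @ \oo --> (l : R[i]^o) -> (forall N, normc (u N) <= C) -> normc l <= C.
Proof.
move=> ul uC; apply/ler_addgt0Pr => e e0.
have e0C : (0 : R[i]) < e%:C by rewrite ltcR.
move/cvgrPdist_lt : ul => /(_ _ e0C)[M _ /(_ M (leqnn M))] /=.
rewrite normc_complexE ltcR => h; have := le_normcD (l - u M) (u M).
by rewrite subrK => h2; have := uC M; lra.
Qed.

Lemma complex_cvg (u : nat -> R[i]^o) : cvgn (Re \o u) -> cvgn (Im \o u) ->
  u @ \oo --> ((limn (Re \o u) +i* limn (Im \o u)) : R[i]^o).
Proof.
move=> cR cI; apply/cvgrPdist_lt => e.
(* Here [e] ranges over the positive elements of [R[i]]; the partial order forces them to be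
   real. *)
have [->|e0] := eqVneq e (Re e)%:C; last first.
  by rewrite ltcE/= => /andP[/eqP Ie _]; case: e e0 Ie => a b /= /[swap] -> /eqP.
rewrite ltcR => {}e0; have e20 : 0 < Re e / 2 by rewrite divr_gt0.
move/cvgrPdist_lt : cR => /(_ _ e20)[M1 _ h1].
move/cvgrPdist_lt : cI => /(_ _ e20)[M2 _ h2].
exists (maxn M1 M2) => // N /=; rewrite geq_max => /andP[N1 N2].
rewrite normc_complexE ltcR; apply: le_lt_trans (normc_le_ReIm _) _.
have := h1 N N1; have := h2 N N2; rewrite /= !ReD !ImD.
case: (u N) => a b /=; lra.
Qed.

End convergence.

Theorem theorem1p3 (R : realType)
  (G : R * R -> R * R -> R) (hG : green_function G)
  (Rm : tensor4 R) (hRm : wp_curvature_tensor Rm) :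
  bounded_curvature_operator Rm /\
  (forall V : bivector R, square_summable V -> eu_norm V = 1 ->
     `|Qtilde Rm V V| <= (16 * Num.sqrt (3 / pi))%:C).
Proof.
have area0 : 0 < @area R := lt_le_trans ltr01 area_ge1.
have pi0 : 0 < pi :> R := pi_gt0 R.
pose g := @area R / pi; have g0 : 0 < g by exact: divr_gt0.
have QE V W : Qtilde_trunc Rm V W = Bform (coef11 V) (coef11 W).
  by apply/funext => N; exact: Qtilde_truncE.
have csqb (V : bivector R) : square_summable V ->
    exists C, forall N, csq (coef11 V) N <= C.
  move=> /nsq_bounded[C hC]; exists (4 * C) => N.
  by apply: le_trans (csq_coef11_le _ _) _; rewrite ler_wpM2l.
have cvQ V W : square_summable V -> square_summable W ->
    cvgn (Re \o Qtilde_trunc Rm V W) /\ cvgn (Im \o Qtilde_trunc Rm V W).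
  move=> /csqb[C hC] /csqb[E hE]; rewrite QE.
  split; apply: cauchy_seq_cvg => e e0;
    have [M hM] := Bform_cauchy hG hC hE e0; exists M => N MN.
    exact: le_lt_trans (normc_ge_ReB _ _) (hM N MN).
  exact: le_lt_trans (normc_ge_ImB _ _) (hM N MN).
(* The truncated squared norms are nondecreasing and bounded, so each lies below the limit that
   defines [eu_norm]. *)
have eu_le V : square_summable V ->
    forall N, g * Num.sqrt (nsq V N) <= eu_norm V.
  move=> sV N; have [C hC] := nsq_bounded sV.
  have euE : eu_trunc V V = (fun N => g ^+ 2 * nsq V N).
    by apply/funext => n; exact: eu_truncE.
  have mono : {homo eu_trunc V V : M N / (M <= N)%N >-> M <= N}.
    by move=> M M' MM'; rewrite euE ler_wpM2l ?sqr_ge0// nsq_mono.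
  have cv : cvgn (eu_trunc V V).
    apply: nondecreasing_is_cvgn => //; exists (g ^+ 2 * C) => _ [n _ <-].
    by rewrite euE ler_wpM2l ?sqr_ge0.
  have h := nondecreasing_cvgn_le mono cv N.
  rewrite -{1}(ger0_norm (ltW g0)) -sqrtr_sqr -sqrtrM ?sqr_ge0//.
  rewrite /eu_norm ler_wsqrtr//; apply: le_trans h.
  by rewrite euE.
have bound V W : square_summable V -> square_summable W -> forall N,
    normc (Qtilde_trunc Rm V W N) <= 6 * eu_norm V * eu_norm W.
  move=> sV sW N; rewrite QE; apply: le_trans (Bform_le hG _ _ _) _.
  have sq (U : bivector R) : Num.sqrt (csq (coef11 U) N) <= 2 * Num.sqrt (nsq U N).
    rewrite -[2]ger0_norm// -sqrtr_sqr -sqrtrM ?sqr_ge0// ler_wsqrtr//.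
    by apply: le_trans (csq_coef11_le _ _) _; rewrite expr2; lra.
  have {}sq U : square_summable U ->
      Num.sqrt (csq (coef11 U) N) <= 2 * (g^-1 * eu_norm U).
    move=> sU; apply: le_trans (sq U) _; rewrite ler_wpM2l//.
    by rewrite ler_pdivlMl//; exact: eu_le.
  have hVW : Num.sqrt (csq (coef11 V) N) * Num.sqrt (csq (coef11 W) N) <=
      4 * (g^-1 * eu_norm V * (g^-1 * eu_norm W)).
    apply: le_trans (ler_pM (sqrtr_ge0 _) (sqrtr_ge0 _) (sq V sV) (sq W sW)) _.
    by rewrite le_eqVlt; apply/orP; left; apply/eqP; ring.
  have k0 : 0 <= 3 / (4 * pi) * g by rewrite mulr_ge0 ?ltW// divr_gt0 ?mulr_gt0.
  apply: le_trans (ler_wpM2l k0 (ler_wpM2l _ hVW)) _ => //.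
  (* The constants collect to 3/(4 pi) g * 2 * 4 g^(-2) = 6/(pi g), and pi g is the area. *)
  apply: (@le_trans _ _ (6 / @area R * (eu_norm V * eu_norm W))).
    rewrite le_eqVlt; apply/orP; left; apply/eqP; rewrite /g.
    move: (eu_norm V) (eu_norm W) (@area R) (pi : R) area0 pi0 {g0 sq hVW k0 eu_le g}.
    move=> x y a P a0 P0; field.
    by rewrite !gt_eqF.
  rewrite -[leRHS]mulrA ler_wpM2r ?mulr_ge0 ?sqrtr_ge0// ler_pdivrMr//.
  by rewrite ler_peMr// area_ge1.
have cvC V W sV sW := complex_cvg (cvQ V W sV sW).1 (cvQ V W sV sW).2.
have Qle V W : square_summable V -> square_summable W ->
    `|Qtilde Rm V W| <= (6 * eu_norm V * eu_norm W)%:C.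
  move=> sV sW; rewrite /Qtilde (cvg_lim _ (cvC V W sV sW))//.
  by rewrite normc_complexE lecR; apply: normc_lim_le (cvC V W sV sW) (bound V W sV sW).
split.
  split; last by exists 6; exact: Qle.
  by move=> V W sV sW; apply/cvg_ex; eexists; exact: cvC.
move=> V sV V1; apply: le_trans (Qle V V sV sV) _; rewrite V1 !mulr1 lecR.
(* The value 3/8 is 6/16; after squaring, pi < 4 is more than enough. *)
have h : 3 / 8 <= Num.sqrt (3 / pi) :> R.
  have h38 : 0 <= 3 / 8 :> R by rewrite divr_ge0.
  rewrite -[leLHS](ger0_norm h38) -sqrtr_sqr ler_wsqrtr// ler_pdivlMr//.
  by have := pihalf_lt2 R; move: (pi : R) => P; lra.
by lra.
Qed.
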